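(* Let $n$ be a positive integer. For any pair of integers $(d_1,d_2)$ satisfying $d_1+d_2=3n-1$ and $n\le d_1\le d_2\le 2n-1$, there exists an arrangement $\mathcal{A}\in \mathrm{Tr}(n,n,n)$ which is free with exponents $(d_1,d_2)$.
   Context: We work in $\mathbb{P}^2$ over $\mathbb{C}$. A line arrangement $\mathcal{A}=\{l_1,\dots,l_m\}$ is a finite set of distinct lines in $\mathbb{P}^2$; let $f=\prod f_i$ be its defining equation. The sheaf $\mathcal{T}_{\mathcal{A}}$ (a rank 2 vector bundle) is defined by $$0\to \mathcal{T}_{\mathcal{A}}\to \mathcal{O}_{\mathbb{P}^2}^3\xrightarrow{\nabla f}\mathcal{J}_f(m-1)\to 0,$$ where $\mathcal{J}_f$ is the ideal sheaf generated by $\nabla f=(\partial_x f,\partial_y f,\partial_z f)$. The arrangement is free with exponents $(\alpha,\beta)$ if $\mathcal{T}_{\mathcal{A}}\cong \mathcal{O}_{\mathbb{P}^2}(-\alpha)\oplus\mathcal{O}_{\mathbb{P}^2}(-\beta)$. For three non-aligned points $A,B,C$ and $0\le a\le b\le c$, $\mathrm{Tr}(a,b,c)$ denotes the set of arrangements every line of which passes through $A$, $B$ or $C$, containing the three side lines $(AB),(AC),(BC)$, and having $a+1$ lines through $A$, $b+1$ through $B$, $c+1$ through $C$ (side lines included in these counts); such an arrangement has $a+b+c$ lines. *)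

(* Defs.v *)
From HB Require Import structures.
From mathcomp Require Import all_boot all_order all_algebra.
From mathcomp Require Import reals complex.
From mathcomp Require Import mpoly.

Set Implicit Arguments.
Unset Strict Implicit.
Unset Printing Implicit Defensive.

Import Order.TTheory GRing.Theory Num.Theory.

Local Open Scope ring_scope.

(* P^2 over K: a point is given by homogeneous coordinates p : 'rV[K]_3 with
   p != 0, and a line by the coefficients l : 'rV[K]_3, l != 0, of a linear
   form. Both are determined up to a nonzero scalar, i.e. by their row space. *)
Section ProjectivePlane.
Variable K : fieldType.

Definition linear_form (l : 'rV[K]_3) : {mpoly K[3]} :=
  \sum_(i < 3) l 0 i *: 'X_i.

Definition on_line (l p : 'rV[K]_3) : bool := (linear_form l).@[p 0] == 0.

(* Forces each of the three coordinate vectors to be nonzero, since there is a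
   line through any two given points. *)
Definition non_aligned (A B C : 'rV[K]_3) : Prop :=
  forall l : 'rV[K]_3, l != 0 -> ~~ [&& on_line l A, on_line l B & on_line l C].

Definition line_arrangement (L : seq 'rV[K]_3) : bool :=
  all (fun l => l != 0) L && pairwise (fun l l' => ~~ (l == l')%MS) L.

Definition defining_equation (L : seq 'rV[K]_3) : {mpoly K[3]} :=
  \prod_(l <- L) linear_form l.

Definition Tr (A B C : 'rV[K]_3) (a b c : nat) (L : seq 'rV[K]_3) : bool :=
  [&& line_arrangement L,
      all (fun l => [|| on_line l A, on_line l B | on_line l C]) L,
      has (fun l => on_line l A && on_line l B) L,
      has (fun l => on_line l A && on_line l C) L,
      has (fun l => on_line l B && on_line l C) L
    & [&& count (fun l => on_line l A) L == a.+1,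
          count (fun l => on_line l B) L == b.+1
        & count (fun l => on_line l C) L == c.+1]].

(* A Zariski open subset of P^2, represented by its cone in K^3 minus 0. *)
Definition zariski_open (U : 'rV[K]_3 -> Prop) : Prop :=
  exists I : {mpoly K[3]} -> Prop,
    (forall g, I g -> exists d : nat, g \is d.-homog) /\
    (forall p, U p <-> p != 0 /\ exists2 g, I g & g.@[p 0] != 0).

(* s is a section over U of O(k): a function on the cone of U that is locally
   g / h with g, h homogeneous and deg g - deg h = k. This is the classical
   description of O(k), valid over an algebraically closed K. The values of s
   outside U are irrelevant. *)
Definition section_O (k : int) (U : 'rV[K]_3 -> Prop) (s : 'rV[K]_3 -> K) :
    Prop :=
  forall p, U p ->
  exists V : 'rV[K]_3 -> Prop, exists g h : {mpoly K[3]}, exists d e : nat,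
    [/\ zariski_open V, V p, (forall q, V q -> U q),
        [/\ g \is d.-homog, h \is e.-homog & d%:Z = e%:Z + k]
      & forall q, V q -> h.@[q 0] != 0 /\ s q = g.@[q 0] / h.@[q 0]].

(* Sheaves are given by their sections F U over each open U, which are
   K^r-valued functions on the cone of U, considered up to equality on U;
   restriction to a smaller open set is restriction of functions. *)
Definition sheaf (r : nat) : Type :=
  ('rV[K]_3 -> Prop) -> ('rV[K]_3 -> 'rV[K]_r) -> Prop.

(* O(k_1) (+) ... (+) O(k_r) *)
Definition sum_O (r : nat) (k : r.-tuple int) : sheaf r :=
  fun U s => forall i : 'I_r, section_O (tnth k i) U (fun p => s p 0 i).

(* The kernel of the map O^3 -> J_f(m - 1) given by the gradient of f; as
   J_f(m - 1) is a subsheaf of O(m - 1), a section is in the kernel when its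
   image vanishes as a function. *)
Definition T_sheaf (L : seq 'rV[K]_3) : sheaf 3 :=
  fun U s => sum_O [tuple 0; 0; 0] U s /\
    forall p, U p ->
      \sum_(i < 3) s p 0 i * ((defining_equation L)^`M(i)).@[p 0] = 0.

Definition eq_on (r : nat) (U : 'rV[K]_3 -> Prop) (s t : 'rV[K]_3 -> 'rV[K]_r) :
    Prop :=
  forall p, U p -> s p = t p.

(* Isomorphism of sheaves of O-modules. With V = U, the naturality clause also
   says that phi U is well defined modulo equality on U. *)
Definition sheaf_iso (r r' : nat) (F : sheaf r) (G : sheaf r') : Prop :=
  exists phi : ('rV[K]_3 -> Prop) ->
               ('rV[K]_3 -> 'rV[K]_r) -> ('rV[K]_3 -> 'rV[K]_r'),
    (forall U V s t, zariski_open U -> zariski_open V ->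
       (forall p, V p -> U p) -> F U s -> F V t ->
       eq_on V t s -> eq_on V (phi V t) (phi U s)) /\
    (forall U, zariski_open U ->
       [/\ (forall s, F U s -> G U (phi U s)),
           (forall s t, F U s -> F U t ->
              eq_on U (phi U (fun p => s p + t p))
                      (fun p => phi U s p + phi U t p)),
           (forall c s, section_O 0 U c -> F U s ->
              eq_on U (phi U (fun p => c p *: s p))
                      (fun p => c p *: phi U s p)),
           (forall s t, F U s -> F U t ->
              eq_on U (phi U s) (phi U t) -> eq_on U s t)
         & (forall t, G U t -> exists2 s, F U s & eq_on U (phi U s) t)]).

Definition free_with_exponents (L : seq 'rV[K]_3) (alpha beta : int) : Prop :=
  sheaf_iso (T_sheaf L) (sum_O [tuple - alpha; - beta]).

End ProjectivePlane.

(* Main.v *)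
(* Let x, y, z be the linear forms dual to A, B, C. Put m = n - 1, k = d1 - n,
   N = m + k and let q be a primitive N-th root of unity. Start from the complete
   monomial arrangement xyz (x^N - y^N) (z^N - y^N) (x^N - z^N), which is free with
   exponents (N + 1, 2N + 1), and remove k consecutive lines through each vertex,
   with equations g1 (x, y), g2 (z, y), g3 (x, z), so that no three removed lines
   meet; this is possible since 2k <= m. If h1, h2, h3 are the equations of the
   remaining lines, there are forms a, b, c with
     h1 = g2 b + g3 a,   h2 = g1 b - g3 c,   h3 = g1 a + g2 c,
   and in the basis A, B, C the logarithmic vector fields
     (x^(N+1), y^(N+1), z^(N+1))  and  (x g2 b c, - y g3 a c, - z g1 a b)
   of degrees N + 1 = d1 and 2N + 1 - 3k = d2 have, together with the Euler field,
   determinant proportional to the defining equation; Saito's criterion gives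
   freeness. The case n = 1 (where N = 0) is the triangle itself. *)
Require Import Defs.
From HB Require Import structures.
From mathcomp Require Import all_boot all_order all_algebra.
From mathcomp Require Import reals complex.
From mathcomp Require Import mpoly.
From mathcomp Require Import boolp cyclic separable cyclotomic.
From mathcomp Require Import ring zify.

Set Implicit Arguments.
Unset Strict Implicit.
Unset Printing Implicit Defensive.

Import Order.TTheory GRing.Theory Num.Theory.

Local Open Scope ring_scope.

(** * Divisibility by products of linear forms *)

Section LinearForms.
Variable K : numFieldType.
Local Notation S := {mpoly K[3]}.
Implicit Types (p q : S) (l : 'rV[K]_3).

Definition mdvd p q := exists r, q = p * r.

Lemma mdvdD p q r : mdvd p q -> mdvd p r -> mdvd p (q + r).
Proof. by move=> [u ->] [v ->]; exists (u + v); rewrite mulrDr. Qed.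

Lemma mdvd_mulr p q r : mdvd p q -> mdvd p (q * r).
Proof. by move=> [u ->]; exists (u * r); rewrite mulrA. Qed.

Lemma mdvd_mull p q r : mdvd p q -> mdvd p (r * q).
Proof. by rewrite mulrC; apply: mdvd_mulr. Qed.

Lemma mdvdZ p q (c : K) : mdvd p q -> mdvd p (c *: q).
Proof. by rewrite -mul_mpolyC; apply: mdvd_mull. Qed.

Lemma linear_formD l l' : linear_form (l + l') = linear_form l + linear_form l'.
Proof.
by rewrite /linear_form -big_split; apply: eq_bigr => i _; rewrite mxE scalerDl.
Qed.

Lemma linear_formZ c l : linear_form (c *: l) = c *: linear_form l.
Proof.
by rewrite /linear_form scaler_sumr; apply: eq_bigr => i _; rewrite mxE scalerA.
Qed.

Lemma mcoeff_linear_form l i : (linear_form l)@_U_(i) = l 0 i.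
Proof.
rewrite /linear_form raddf_sum (bigD1 i) //= big1 ?addr0.
  by rewrite mcoeffZ mcoeffXU eqxx mulr1.
by move=> j /negPf ji; rewrite mcoeffZ mcoeffXU ji mulr0.
Qed.

Lemma linear_form_eq0 l : (linear_form l == 0) = (l == 0).
Proof.
apply/eqP/eqP => [l0|->].
  by apply/rowP => i; rewrite mxE -mcoeff_linear_form l0 mcoeff0.
by rewrite /linear_form big1 // => i _; rewrite mxE scale0r.
Qed.

Lemma dhomog_linear_form l : linear_form l \is 1.-homog.
Proof.
by apply: rpred_sum => i _; apply: rpredZ; rewrite dhomogX /= mdeg1.
Qed.

Lemma meval_linear_form l v : (linear_form l).@[v] = \sum_i l 0 i * v i.
Proof.
by rewrite /linear_form raddf_sum; apply: eq_bigr => i _; rewrite /= mevalZ mevalXU.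
Qed.

Lemma row_neq0_coord l : l != 0 -> exists j, l 0 j != 0.
Proof.
move=> l0; apply/existsP; apply: contraNT l0; rewrite negb_exists => /forallP h.
by apply/eqP/rowP => i; rewrite mxE; apply/eqP; move/negPn: (h i).
Qed.

(* Substituting the value of ['X_j] on the line [l = 0] is a retraction of the
   polynomial ring whose kernel is the ideal of the line. *)
Definition elim_var l (j : 'I_3) : 3.-tuple S :=
  [tuple 'X_i - (if i == j then (l 0 j)^-1 *: linear_form l else 0) | i < 3].

(** Congruence modulo [linear_form l] is compatible with sums and products, so it suffices to
    compare each variable with its image. *)
Lemma elim_var_congr l j p : mdvd (linear_form l) (p - (p \mPo elim_var l j)).
Proof.
elim/mpolyind: p => [|c m p _ _ ih].
  by rewrite comp_mpoly0 subr0; exists 0; rewrite mulr0.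
rewrite comp_mpolyD opprD addrACA; apply: mdvdD ih.
rewrite comp_mpolyZ -scalerBr; apply: mdvdZ.
rewrite comp_mpolyX -[X in X - _]/('X_[m] : S) mpolyXE_id.
pose cong (u v : S) := mdvd (linear_form l) (u - v).
have congM u u' v v' : cong u u' -> cong v v' -> cong (u * v) (u' * v').
  move=> cu cv; rewrite /cong.
  have -> : u * v - u' * v' = (u - u') * v + u' * (v - v') by ring.
  by apply: mdvdD; [apply: mdvd_mulr | apply: mdvd_mull].
have cong1 : cong 1 1 by rewrite /cong subrr; exists 0; rewrite mulr0.
apply: (big_ind2 cong) => // i _; elim: (m i) => [|k ihk].
  by rewrite !expr0.
rewrite !exprS; apply: congM ihk; rewrite tnth_mktuple /cong subKr.
case: eqP => _; last by exists 0; rewrite mulr0.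
by exists (l 0 j)^-1%:MP; rewrite mulrC mul_mpolyC.
Qed.

(** When [l 0 j] is nonzero, the substitution clears the [j]-th coefficient of a linear form by
    means of [l]; among linear forms it kills exactly the multiples of [l]. *)
Lemma elim_var_form l j l' :
  linear_form l' \mPo elim_var l j = linear_form (l' - (l' 0 j / l 0 j) *: l).
Proof.
rewrite linear_formD -scaleNr linear_formZ {1}/linear_form raddf_sum /=.
under eq_bigr => i _ do
  rewrite comp_mpolyZ comp_mpolyXU -tnth_nth tnth_mktuple scalerBr.
rewrite big_split /=; congr (_ + _).
rewrite (bigD1 j) //= eqxx scalerA scaleNr big1 ?addr0 //.
by move=> i /negPf ->; rewrite scaler0 oppr0.
Qed.

Lemma elim_var_dvd l j p :
  l 0 j != 0 -> mdvd (linear_form l) p -> p \mPo elim_var l j = 0.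
Proof.
move=> lj [r ->]; rewrite rmorphM /= elim_var_form divff // scale1r subrr.
by have /eqP -> : linear_form (0 : 'rV[K]_3) == 0; rewrite ?linear_form_eq0 ?mul0r.
Qed.

(** The ideal of a line is prime, being the kernel of an endomorphism of an integral domain; [l'] is
    not killed because the lines differ. *)
Lemma line_prime l l' p : l != 0 -> l' != 0 -> ~~ (l == l')%MS ->
  mdvd (linear_form l) (linear_form l' * p) -> mdvd (linear_form l) p.
Proof.
move=> /row_neq0_coord[j lj] l'0 ll' /(elim_var_dvd lj) /eqP.
rewrite rmorphM /= mulf_eq0 elim_var_form linear_form_eq0 => /orP[|/eqP p0].
  rewrite subr_eq0 => /eqP l'E; case/negP: ll'.
  have c0 : l' 0 j / l 0 j != 0.
    by apply: contraNneq l'0 => c0; rewrite l'E c0 scale0r.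
  by rewrite l'E; apply/eqmxP/eqmx_sym/eqmx_scale.
by have := elim_var_congr l j p; rewrite p0 subr0.
Qed.

Lemma line_prime_prod l (s : seq 'rV[K]_3) p : l != 0 ->
  all (fun l' => (l' != 0) && ~~ (l == l')%MS) s ->
  mdvd (linear_form l) (p * defining_equation s) -> mdvd (linear_form l) p.
Proof.
move=> l0; rewrite /defining_equation.
elim: s p => [|l' s ih] p; first by rewrite big_nil mulr1.
case/andP => /andP[l'0 ll'] sP; rewrite big_cons mulrA => /(ih _ sP).
by rewrite mulrC; apply: line_prime.
Qed.

(** One line is split off at a time; the others still divide the cofactor, since they are prime to
    the line removed. *)
Lemma defining_equation_dvd (s : seq 'rV[K]_3) p : line_arrangement s ->
  (forall l, l \in s -> mdvd (linear_form l) p) -> mdvd (defining_equation s) p.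
Proof.
rewrite /line_arrangement /defining_equation.
elim: s p => [|l s ih] p /=.
  by move=> _ _; exists p; rewrite big_nil mul1r.
case/andP => /andP[l0 s0] /andP[ls ss] dvd_p.
have [r pE] := dvd_p l (mem_head _ _).
have [||t rE] := ih r; first by rewrite s0 ss.
  move=> l' l's; apply: (@line_prime l' l) => //.
  - exact: (allP s0).
  - by have := allP ls _ l's; apply: contra; case/andP => h1 h2; rewrite /eqmx h2 h1.
  - by rewrite -pE; apply: dvd_p; rewrite inE l's orbT.
by exists t; rewrite big_cons pE rE mulrA.
Qed.

Lemma defining_equation_neq0 (s : seq 'rV[K]_3) :
  all (fun l => l != 0) s -> defining_equation s != 0.
Proof.
rewrite /defining_equation => /allP s0; rewrite prodf_seq_neq0; apply/allP => l ls.
by rewrite linear_form_eq0 s0.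
Qed.

Lemma dhomog_defining_equation (s : seq 'rV[K]_3) :
  defining_equation s \is (size s).-homog.
Proof.
rewrite /defining_equation; elim: s => [|l s ih]; rewrite (big_nil, big_cons).
  exact: dhomog1.
exact: (dhomogM (dhomog_linear_form l) ih).
Qed.

Lemma pihomogM d e p q : p \is d.-homog ->
  pihomog mdeg (d + e) (p * q) = p * pihomog mdeg e q.
Proof.
move=> hp; elim/mpolyind: q => [|c m q _ _ ih]; first by rewrite mulr0 !pihomog0 mulr0.
rewrite mulrDr !pihomogD mulrDr ih; congr (_ + _).
have hX (k : nat) : ('X_[m] : S) \is k.-homog = (mdeg m == k) by rewrite dhomogX.
have hcX : c *: 'X_[m] \is [in K[3], (mdeg m).-homog] by rewrite rpredZ // hX.
have [me|me] := eqVneq (mdeg m) e.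
  by rewrite -me !pihomog_dE //; apply: dhomogM.
rewrite (pihomog_ne0 me hcX) mulr0 (pihomog_ne0 _ (dhomogM hp hcX)) //.
by rewrite eqn_add2l.
Qed.

(** [p * q] is its own component of degree [d + e], which is [p] times the component of degree [e]
    of [q]; then [p] cancels. *)
Lemma dhomog_quotient d e p q : p != 0 -> p \is d.-homog ->
  p * q \is (d + e).-homog -> q \is e.-homog.
Proof.
move=> p0 hp; rewrite !homog_piE pihomogM // => /eqP h.
by apply/eqP/(mulfI p0).
Qed.

End LinearForms.

(** * Points where a nonzero polynomial does not vanish *)

Section NonVanishing.
Variable K : numFieldType.

(** In characteristic zero the natural numbers are distinct in [K], and [size p] of them cannot all
    be roots. *)
Lemma exists_nonroot (p : {poly K}) : p != 0 -> exists t, p.[t] != 0.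
Proof.
move=> p0; pose rs : seq K := [seq i%:R | i <- iota 0 (size p)].
have : ~~ all (root p) rs.
  apply/negP => rsP; have := max_poly_roots p0 rsP.
  rewrite map_inj_uniq ?iota_uniq; last by move=> i j /eqP; rewrite eqr_nat => /eqP.
  by rewrite size_map size_iota ltnn => /(_ isT).
by case/allPn => t _ tP; exists t.
Qed.

Lemma muni_eq0 n (p : {mpoly K[n.+1]}) : muni p = 0 -> p = 0.
Proof.
move=> p0; apply/mpolyP => m; rewrite mcoeff0.
have [mp|] := boolP (m \in msupp p); last by rewrite mcoeff_msupp negbK => /eqP.
(* [w m] forgets the last exponent of [m]; with that exponent it determines [m], so the coefficient
   of [p] at [m] occurs alone in [muni p]. *)
pose w (m' : 'X_{1..n.+1}) := [multinom m' (widen_ord (leqnSn n) i) | i < n].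
have := congr1 (fun q : {poly {mpoly K[n]}} => (q`_(m ord_max))@_(w m)) p0.
rewrite muniE coef_sum raddf_sum /= coef0 mcoeff0 (bigD1_seq m) ?msupp_uniq //=.
rewrite coefZ coefXn eqxx mulr1 mcoeffZ mcoeffX eqxx mulr1 big1 ?addr0 // => m' m'm.
rewrite coefZ coefXn; case: eqP => [mm|_]; last by rewrite mulr0 mcoeff0.
rewrite mulr1 mcoeffZ mcoeffX; case: eqP => [wm|_]; last by rewrite mulr0.
case/eqP: m'm; apply/mnmP => i; have [j ->|->] := unliftP ord_max i; last by rewrite mm.
have -> : lift ord_max j = widen_ord (leqnSn n) j by apply/val_inj/lift_max.
by have := congr1 (fun u : 'X_{1..n} => u j) wm; rewrite !mnmE.
Qed.

(** Induction on the number of variables: the first ones are chosen off the zeros of the leading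
    coefficient in the last variable, then the last one off finitely many roots. *)
Lemma exists_mpoly_nonroot n (p : {mpoly K[n]}) : p != 0 -> exists v, p.@[v] != 0.
Proof.
elim: n p => [|n ih] p p0.
  exists (fun=> 0); rewrite [p]nvar0_mpolyC mevalC.
  by apply: contraNneq p0 => p0; rewrite [p]nvar0_mpolyC p0.
have /ih[v] : lead_coef (muni p) != 0.
  by rewrite lead_coef_eq0; apply: contraNneq p0 => /muni_eq0 ->.
move=> lv; have [|t tP] := @exists_nonroot (map_poly (meval v) (muni p)).
  by apply: contraNneq lv => q0; rewrite lead_coefE -coef_map q0 coef0.
exists (fun i => if unlift ord_max i is Some j then v j else t).
move: tP; congr (_ != 0); rewrite muniE rmorph_sum horner_sum /=.
rewrite mevalE; apply: eq_bigr => m _.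
rewrite map_polyZ /= map_polyXn hornerZ hornerXn mevalZ mevalX -mulrA; congr (_ * _).
rewrite big_ord_recr /= unlift_none; congr (_ * _); apply: eq_bigr => i _.
have -> : widen_ord (leqnSn n) i = lift ord_max i by apply/val_inj/esym/lift_max.
rewrite liftK mnmE; congr (_ ^+ m _); exact/val_inj/esym/lift_max.
Qed.

End NonVanishing.

(** * Saito's criterion *)

Section Syzygies.
Variable K : numFieldType.
Local Notation S := {mpoly K[3]}.
Implicit Types (p q : S) (l : 'rV[K]_3) (u v w : 'I_3 -> S) (s : seq 'rV[K]_3).

Lemma ord3_ind (P : 'I_3 -> Prop) : P 0 -> P 1 -> P 2 -> forall i, P i.
Proof.
move=> P0 P1 P2 [[|[|[|//]]] i3].
- by have -> : Ordinal i3 = 0 by apply: val_inj.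
- by have -> : Ordinal i3 = 1 by apply: val_inj.
- by have -> : Ordinal i3 = 2 by apply: val_inj.
Qed.

Lemma sum_ord3 (V : nmodType) (F : 'I_3 -> V) : \sum_i F i = F 0 + F 1 + F 2.
Proof.
rewrite !big_ord_recl big_ord0 addr0 addrA.
by congr (F _ + F _ + F _); apply: val_inj.
Qed.

Definition der u p := \sum_i u i * p^`M(i).

Definition euler : 'I_3 -> S := fun i => 'X_i.

(** Expanded so that [ring] can prove identities about it. *)
Definition det3 (R : comNzRingType) (u v w : 'I_3 -> R) :=
  u 0 * (v 1 * w 2 - v 2 * w 1) - u 1 * (v 0 * w 2 - v 2 * w 0)
  + u 2 * (v 0 * w 1 - v 1 * w 0).

Lemma der_linear_form u l : der u (linear_form l) = \sum_i l 0 i *: u i.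
Proof.
apply: eq_bigr => i _; rewrite /linear_form raddf_sum (bigD1 i) //= big1.
  rewrite mderivZ mderivX mnm1E eqxx scale1r.
  have -> : (U_(i) - U_(i) = 0 :> 'X_{1..3})%MM by apply/mnmP => j; rewrite !mnmE subnn.
  by rewrite mpolyX0 addr0 mulrC -mul_mpolyC -mul_mpolyC mulr1.
by move=> j /negPf ji; rewrite mderivZ mderivX mnm1E ji scale0r scaler0.
Qed.

Lemma der_euler_linear_form l : der euler (linear_form l) = linear_form l.
Proof. by rewrite der_linear_form. Qed.

Lemma derM u p q : der u (p * q) = der u p * q + p * der u q.
Proof.
rewrite /der mulr_suml mulr_sumr -big_split; apply: eq_bigr => i _ /=.
by rewrite mderivM; ring.
Qed.

Lemma der1 u : der u 1 = 0.
Proof. by rewrite /der big1 // => i _; rewrite mderivC mulr0. Qed.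

Lemma derDl u v p : der (fun i => u i + v i) p = der u p + der v p.
Proof. by rewrite /der -big_split; apply: eq_bigr => i _; rewrite mulrDl. Qed.

Lemma derMl a u p : der (fun i => a * u i) p = a * der u p.
Proof. by rewrite /der mulr_sumr; apply: eq_bigr => i _; rewrite mulrA. Qed.

Lemma eq_der u v p : u =1 v -> der u p = der v p.
Proof. by move=> uv; apply: eq_bigr => i _; rewrite uv. Qed.

(** Tangency is tested line by line; for distinct lines this amounts to preserving the ideal of
    [defining_equation s]. *)
Definition logarithmic u s :=
  forall l, l \in s -> mdvd (linear_form l) (der u (linear_form l)).

Lemma der_euler s : der euler (defining_equation s) = (size s)%:R * defining_equation s.
Proof.
rewrite /defining_equation; elim: s => [|l s ih].
  by rewrite big_nil der1 mul0r.
by rewrite big_cons derM ih der_euler_linear_form [size _]/= -natr1; ring.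
Qed.

(** By the Leibniz rule, the eigenvalue is the sum over the lines of the quotients of
    [der u (linear_form l)] by [linear_form l]. *)
Lemma logarithmic_eigen d u s : (forall l, l \in s -> l != 0) ->
  (forall i, u i \is d.+1.-homog) -> logarithmic u s ->
  exists2 r, r \is d.-homog & der u (defining_equation s) = r * defining_equation s.
Proof.
move=> + hu; rewrite /defining_equation; elim: s => [|l s ih] s0 ulog.
  by exists 0; rewrite ?rpred0 // big_nil der1 mul0r.
have [|l' l's|r hr rE] := ih; first by move=> l' l's; rewrite s0 // inE l's orbT.
  by apply: ulog; rewrite inE l's orbT.
have [q qE] := ulog _ (mem_head _ _).
exists (q + r); last by rewrite big_cons derM rE qE; ring.
apply: rpredD => //; apply: (@dhomog_quotient _ 1 d (linear_form l)).
- by rewrite linear_form_eq0 s0 ?mem_head.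
- exact: dhomog_linear_form.
by rewrite -qE der_linear_form add1n; apply: rpred_sum => i _; apply/rpredZ/hu.
Qed.

Lemma pairwise_rem (T : eqType) (r : rel T) (x : T) (t : seq T) :
  ssrbool.symmetric r -> pairwise r t -> x \in t -> all (r x) (rem x t).
Proof.
move=> r_sym; elim: t => //= y t ih /andP[yt tt]; rewrite inE.
have [yx _|yx /= xt] := eqVneq y x; first by rewrite -yx.
rewrite ih // andbT r_sym; exact: (allP yt _ xt).
Qed.

(** If the equation is [l g], the Leibniz rule gives [g D(l) = - l D(g)], and [l] is prime to [g]
    since the lines are distinct. *)
Lemma logarithmic_der0 u s : line_arrangement s ->
  der u (defining_equation s) = 0 -> logarithmic u s.
Proof.
case/andP => s0 ss du l ls; have l0 := allP s0 _ ls.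
have fE : defining_equation s = linear_form l * defining_equation (rem l s).
  by rewrite /defining_equation (perm_big _ (perm_to_rem ls)) big_cons.
apply: (@line_prime_prod _ l (rem l s)) => //.
  apply/allP => l' l's; rewrite (allP s0 _ (mem_rem l's)) /=.
  by apply: (allP (pairwise_rem _ ss ls)) l's => l1 l2; rewrite andbC.
exists (- der u (defining_equation (rem l s))).
by move: du; rewrite fE derM => /eqP; rewrite addr_eq0 => /eqP ->; rewrite mulrN.
Qed.

Lemma cramer3 u v w g i :
  det3 u v w * g i = det3 g v w * u i + det3 u g w * v i + det3 u v g * w i.
Proof. by elim/ord3_ind: i; rewrite /det3; ring. Qed.

(** Three fields tangent to a line are dependent along it: [l 0 j] times the determinant is the
    determinant whose [j]-th components are replaced by the derivatives of [linear_form l]. *)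
Lemma det3_dvd u v w l : l != 0 ->
  mdvd (linear_form l) (der u (linear_form l)) ->
  mdvd (linear_form l) (der v (linear_form l)) ->
  mdvd (linear_form l) (der w (linear_form l)) ->
  mdvd (linear_form l) (det3 u v w).
Proof.
have derE g : der g (linear_form l) = \sum_i (l 0 i)%:MP * g i.
  by rewrite der_linear_form; apply: eq_bigr => i _; rewrite mul_mpolyC.
move=> /row_neq0_coord[j lj] [a aE] [b bE] [c cE].
suff [r rE] : mdvd (linear_form l) ((l 0 j)%:MP * det3 u v w).
  exists ((l 0 j)^-1%:MP * r); rewrite mulrCA -rE mulrA -mpolyCM mulVf //.
  by rewrite mpolyC1 mul1r.
move: aE bE cE; rewrite !derE !sum_ord3; move: (linear_form l) => m aE bE cE.
elim/ord3_ind: j lj => _.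
- exists (a * (v 1 * w 2 - v 2 * w 1) - u 1 * (b * w 2 - v 2 * c)
    + u 2 * (b * w 1 - v 1 * c)).
  transitivity (m * a * (v 1 * w 2 - v 2 * w 1) - u 1 * (m * b * w 2 - v 2 * (m * c))
    + u 2 * (m * b * w 1 - v 1 * (m * c))); last by ring.
  by rewrite -aE -bE -cE /det3; ring.
- exists (u 0 * (b * w 2 - v 2 * c) - a * (v 0 * w 2 - v 2 * w 0)
    + u 2 * (v 0 * c - b * w 0)).
  transitivity (u 0 * (m * b * w 2 - v 2 * (m * c)) - m * a * (v 0 * w 2 - v 2 * w 0)
    + u 2 * (v 0 * (m * c) - m * b * w 0)); last by ring.
  by rewrite -aE -bE -cE /det3; ring.
exists (u 0 * (v 1 * c - b * w 1) - u 1 * (v 0 * c - b * w 0)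
    + a * (v 0 * w 1 - v 1 * w 0)).
transitivity (u 0 * (v 1 * (m * c) - m * b * w 1) - u 1 * (v 0 * (m * c) - m * b * w 0)
    + m * a * (v 0 * w 1 - v 1 * w 0)); last by ring.
by rewrite -aE -bE -cE /det3; ring.
Qed.

Lemma dhomog_det3 d1 d2 d3 u v w : (forall i, u i \is d1.-homog) ->
  (forall i, v i \is d2.-homog) -> (forall i, w i \is d3.-homog) ->
  det3 u v w \is (d1 + d2 + d3).-homog.
Proof.
move=> hu hv hw; have h i j k : u i * (v j * w k) \is (d1 + d2 + d3).-homog.
  by rewrite -addnA; apply: dhomogM => //; apply: dhomogM.
by rewrite /det3 !mulrBr; do !apply: rpredB || apply: rpredD.
Qed.

(** A homogeneous basis of the syzygies of the gradient. Spanning is asked in degrees where [e - d1]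
    and [e - d2] are not truncated; locally these degrees are reached by multiplying by a power of a
    coordinate. *)
Record syzygy_basis s (s1 s2 : 'I_3 -> S) (d1 d2 : nat) : Prop := SyzygyBasis {
  syz_homog1 : forall i, s1 i \is d1.-homog;
  syz_homog2 : forall i, s2 i \is d2.-homog;
  syz_der1 : der s1 (defining_equation s) = 0;
  syz_der2 : der s2 (defining_equation s) = 0;
  syz_free : forall a b, (forall i, a * s1 i + b * s2 i = 0) -> a = 0 /\ b = 0;
  syz_span : forall e g, (d1 <= e)%N -> (d2 <= e)%N ->
    (forall i, g i \is e.-homog) -> der g (defining_equation s) = 0 ->
    exists a b, [/\ a \is (e - d1).-homog, b \is (e - d2).-homog
                  & forall i, g i = a * s1 i + b * s2 i] }.

(* Saito's criterion, the Euler field being used to turn logarithmic fields into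
   syzygies of the gradient. *)
Lemma saito_criterion s (t1 t2 : 'I_3 -> S) (d1 d2 : nat) (c : K) :
  line_arrangement s -> size s = (d1.+1 + d2.+1).+1 ->
  (forall i, t1 i \is d1.+1.-homog) -> (forall i, t2 i \is d2.+1.-homog) ->
  logarithmic t1 s -> logarithmic t2 s ->
  c != 0 -> det3 euler t1 t2 = c *: defining_equation s ->
  exists s1 s2 : 'I_3 -> S, syzygy_basis s s1 s2 d1.+1 d2.+1.
Proof.
move=> hs sz ht1 ht2 log1 log2 c0 detE.
have s0 : forall l, l \in s -> l != 0 by case/andP: hs => /allP.
have f0 : defining_equation s != 0 by apply/defining_equation_neq0/allP.
have [r1 hr1 r1E] := logarithmic_eigen s0 ht1 log1.
have [r2 hr2 r2E] := logarithmic_eigen s0 ht2 log2.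
pose k : K := (size s)%:R; have k0 : k != 0 by rewrite pnatr_eq0 sz.
have hE i : euler i \is 1.-homog by rewrite dhomogX /= mdeg1.
have derEk : der euler (defining_equation s) = k%:MP * defining_equation s.
  by rewrite der_euler -mpolyC_nat.
(* The Euler field has eigenvalue [k], so adding [- r / k] times it to a field of eigenvalue [r]
   gives a field killing the equation. *)
pose corr r : S := - ((k^-1)%:MP * r).
pose s1 i := t1 i + corr r1 * euler i; pose s2 i := t2 i + corr r2 * euler i.
have der_corr t r : der t (defining_equation s) = r * defining_equation s ->
    der (fun i => t i + corr r * euler i) (defining_equation s) = 0.
  move=> tE; rewrite derDl derMl tE derEk /corr.
  rewrite mulNr mulrACA -mpolyCM mulVf // mpolyC1 mul1r; exact: subrr.
have hs1 i : s1 i \is d1.+1.-homog.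
  apply: rpredD => //; rewrite -(addn1 d1); apply: dhomogM => //.
  by rewrite rpredN mul_mpolyC rpredZ.
have hs2 i : s2 i \is d2.+1.-homog.
  apply: rpredD => //; rewrite -(addn1 d2); apply: dhomogM => //.
  by rewrite rpredN mul_mpolyC rpredZ.
have ds1 : der s1 (defining_equation s) = 0 by apply: der_corr.
have ds2 : der s2 (defining_equation s) = 0 by apply: der_corr.
(* Adding multiples of the Euler field to the other two does not change the determinant. *)
have detE' : det3 euler s1 s2 = c%:MP * defining_equation s.
  by rewrite mul_mpolyC -detE /det3 /s1 /s2; ring.
have D0 : c%:MP * defining_equation s != 0 by rewrite mul_mpolyC scaler_eq0 negb_or c0.
exists s1, s2; split=> //.
  move=> a b ab; split; apply: (mulIf D0); rewrite mul0r -detE'.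
    transitivity (det3 euler (fun i => a * s1 i + b * s2 i) s2).
      by rewrite /det3; ring.
    by rewrite /det3 !ab; ring.
  transitivity (det3 euler s1 (fun i => a * s1 i + b * s2 i)).
    by rewrite /det3; ring.
  by rewrite /det3 !ab; ring.
move=> e g d1e d2e hg dg.
have logE l : mdvd (linear_form l) (der euler (linear_form l)).
  by rewrite der_euler_linear_form; exists 1; rewrite mulr1.
have dvd u v : der u (defining_equation s) = 0 -> der v (defining_equation s) = 0 ->
    mdvd (defining_equation s) (det3 euler u v).
  move=> du dv; apply: defining_equation_dvd => // l ls.
  by apply: det3_dvd; [apply: s0 | | apply: (logarithmic_der0 hs) ..].
(* Cramer's numerators of [g] along [s1] and [s2]: they are multiples of the defining equation,
   hence of the denominator. *)
have [a aE] := dvd _ _ dg ds2; have [b bE] := dvd _ _ ds1 dg.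
have hf := dhomog_defining_equation s.
have ha : a \is (e - d1.+1).-homog.
  apply: (dhomog_quotient f0 hf); rewrite -aE sz.
  have -> : ((d1.+1 + d2.+1).+1 + (e - d1.+1) = 1 + e + d2.+1)%N.
    by rewrite -addnS addnC addnA (subnK d1e) addnS add1n.
  exact: dhomog_det3.
have hb : b \is (e - d2.+1).-homog.
  apply: (dhomog_quotient f0 hf); rewrite -bE sz.
  have -> : ((d1.+1 + d2.+1).+1 + (e - d2.+1) = 1 + d1.+1 + e)%N.
    by rewrite -addSn -addnA (subnKC d2e) add1n.
  exact: dhomog_det3.
(* The numerator along the Euler field vanishes: applied to the defining equation, Cramer's relation
   keeps only the Euler term, with factor [k]. *)
have A0 : det3 g s1 s2 = 0.
  have : der (fun i => det3 euler s1 s2 * g i) (defining_equation s) =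
      det3 g s1 s2 * (k%:MP * defining_equation s).
    rewrite (eq_der _ (cramer3 _ _ _ _)) !derDl !derMl ds1 ds2 derEk.
    by rewrite !mulr0 !addr0.
  rewrite derMl dg mulr0 => /esym/eqP; rewrite mulf_eq0 => /orP[/eqP //|].
  by rewrite mul_mpolyC scaler_eq0 (negPf k0) (negPf f0).
exists (c^-1 *: a), (c^-1 *: b); split; rewrite ?rpredZ // => i.
apply: (mulfI D0); rewrite -detE' cramer3 A0 mul0r add0r detE' aE bE.
have cc : c%:MP * (c^-1)%:MP = 1 :> S by rewrite -mpolyCM mulfV.
rewrite -!mul_mpolyC.
transitivity (c%:MP * (c^-1)%:MP * defining_equation s * (a * s1 i + b * s2 i)).
  by rewrite cc; ring.
by ring.
Qed.

End Syzygies.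

(** * From a basis of syzygies to a splitting of the sheaf *)

Section FreeSheaf.
Variable K : numFieldType.
Local Notation S := {mpoly K[3]}.
Local Notation cone := ('rV[K]_3 -> Prop).
Implicit Types (U V W : cone) (p q : 'rV[K]_3).

Lemma zariski_openI U V :
  zariski_open U -> zariski_open V -> zariski_open (fun p => U p /\ V p).
Proof.
move=> [I [Ih IU]] [J [Jh JV]].
exists (fun h => exists g g', [/\ I g, J g' & h = g * g']); split.
  move=> _ [g [g' [/Ih[d hg] /Jh[d' hg'] ->]]]; exists (d + d')%N; exact: dhomogM.
move=> p; split.
  case=> /IU[p0 [g Ig gp]] /JV[_ [g' Jg' gp']]; split=> //.
  by exists (g * g'); [exists g, g' | rewrite mevalM mulf_neq0].
case=> p0 [_ [g [g' [Ig Jg' ->]]]]; rewrite mevalM mulf_eq0 negb_or => /andP[gp gp'].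
by split; [apply/IU; split=> //; exists g | apply/JV; split=> //; exists g'].
Qed.

Lemma zariski_open_neq0 d (g : S) : g \is d.-homog ->
  zariski_open (fun p => p != 0 /\ g.@[p 0] != 0).
Proof.
move=> hg; exists (eq g); split=> [_ <-|p]; first by exists d.
by split=> [[p0 gp]|[p0 [_ <- gp]]]; split=> //; exists g.
Qed.

Lemma zariski_dense U p (g : S) : zariski_open U -> U p ->
  (forall q, U q -> g.@[q 0] = 0) -> g = 0.
Proof.
move=> [I [_ IU]] /IU[_ [f If fp]] gU; apply/eqP/negPn/negP => g0.
have f0 : f != 0 by apply: contraNneq fp => ->; rewrite meval0.
have X0 : 'X_0 != 0 :> S by rewrite -msize_poly_eq0 msizeX.
(* The factor [f] puts the point found in [U], and ['X_0] keeps it away from the origin. *)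
have [|v] := @exists_mpoly_nonroot K 3 (g * f * 'X_0).
  by rewrite !mulf_neq0.
rewrite !mevalM mevalXU !mulf_eq0 !negb_or => /andP[/andP[gv fv] v0].
have qE h : h.@[(\row_i v i) 0] = h.@[v] :> K by apply: meval_eq => i; rewrite mxE.
case/eqP: gv; rewrite -qE; apply/gU/IU; split; last by exists f; rewrite // qE.
by apply: contraNneq v0 => /rowP/(_ 0); rewrite !mxE => ->.
Qed.

Lemma ord2_ind (P : 'I_2 -> Prop) : P 0 -> P 1 -> forall i, P i.
Proof.
move=> P0 P1 [[|[|//]] i2].
- by have -> : Ordinal i2 = 0 by apply: val_inj.
- by have -> : Ordinal i2 = 1 by apply: val_inj.
Qed.

Lemma common_denominator U (t : 'rV[K]_3 -> 'rV[K]_3) p :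
  sum_O [tuple 0; 0; 0] U t -> U p ->
  exists V (g : 'I_3 -> S) (h : S) e,
    [/\ zariski_open V, V p, (forall q, V q -> U q),
        h \is e.-homog /\ (forall i, g i \is e.-homog)
      & forall q, V q -> h.@[q 0] != 0 /\ forall i, t q 0 i = (g i).@[q 0] / h.@[q 0]].
Proof.
move=> tO Up.
have frac i : exists V (g h : S) e, [/\ zariski_open V, V p, (forall q, V q -> U q),
    g \is e.-homog /\ h \is e.-homog
    & forall q, V q -> h.@[q 0] != 0 /\ t q 0 i = g.@[q 0] / h.@[q 0]].
  have [V [g [h [d [e [oV Vp VU [hg hh de] E]]]]]] := tO i p Up.
  exists V, g, h, e; split=> //; split=> //; suff <- : d = e by [].
  by apply/eqP; move: de; elim/ord3_ind: i {E} => /eqP; rewrite addr0.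
have [V0 [g0 [h0 [e0 [oV0 V0p V0U [hg0 hh0] E0]]]]] := frac 0.
have [V1 [g1 [h1 [e1 [oV1 V1p _ [hg1 hh1] E1]]]]] := frac 1.
have [V2 [g2 [h2 [e2 [oV2 V2p _ [hg2 hh2] E2]]]]] := frac 2.
exists (fun q => V0 q /\ V1 q /\ V2 q), (fun i => if i == 0 then g0 * h1 * h2
  else if i == 1 then h0 * g1 * h2 else h0 * h1 * g2), (h0 * h1 * h2), (e0 + e1 + e2)%N.
split=> [|//|q [/V0U //]||q [V0q [V1q V2q]]].
- by do 2!(apply: zariski_openI => //).
- split; first by do 2!(apply: dhomogM => //).
  by elim/ord3_ind; do 2!(apply: dhomogM => //).
have [h0q t0q] := E0 q V0q; have [h1q t1q] := E1 q V1q; have [h2q t2q] := E2 q V2q.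
split; first by rewrite !mevalM !mulf_neq0.
by elim/ord3_ind; rewrite /= !mevalM ?t0q ?t1q ?t2q; field; rewrite h0q h1q h2q.
Qed.

Variables (s : seq 'rV[K]_3) (s1 s2 : 'I_3 -> S) (d1 d2 : nat).
Hypothesis basis : syzygy_basis s s1 s2 d1 d2.

Definition fraction_on V (t : 'rV[K]_3 -> 'rV[K]_3) (g0 g1 h : S) :=
  forall q, V q -> h.@[q 0] != 0 /\ forall i,
    t q 0 i = (g0.@[q 0] * (s1 i).@[q 0] + g1.@[q 0] * (s2 i).@[q 0]) / h.@[q 0].

(** [v] is the value at [p] of the coordinates of [t] in the basis [s1], [s2], read off a fraction
    valid near [p]. *)
Definition germ (t : 'rV[K]_3 -> 'rV[K]_3) p (v : 'rV[K]_2) :=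
  exists V (g0 g1 h : S), [/\ zariski_open V, V p, fraction_on V t g0 g1 h,
    v 0 0 = g0.@[p 0] / h.@[p 0] & v 0 1 = g1.@[p 0] / h.@[p 0]].

(** Cross-multiplying two expressions gives a relation between [s1] and [s2] on a nonempty open set,
    hence everywhere. The value at [p] is thus determined by [t] near [p], even where [s1] and [s2]
    become dependent. *)
Lemma germ_unique W t t' p v v' : zariski_open W -> W p ->
  (forall q, W q -> t q = t' q) -> germ t p v -> germ t' p v' -> v = v'.
Proof.
move=> oW Wp tt' [V [g0 [g1 [h [oV Vp E v0 v1]]]]] [V' [g0' [g1' [h' [oV' Vp' E' v0' v1']]]]].
have oVV := zariski_openI oW (zariski_openI oV oV').
have [|hz0 hz1] := syz_free basis (a := g0 * h' - g0' * h) (b := g1 * h' - g1' * h).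
  move=> i; apply: (zariski_dense oVV (p := p)) => [|q [Wq [Vq Vq']]]; first by [].
  have [hq tq] := E q Vq; have [hq' tq'] := E' q Vq'.
  have := tq i; rewrite (tt' q Wq) tq' => /eqP.
  rewrite eqr_div // => /eqP hE.
  transitivity ((g0.@[q 0] * (s1 i).@[q 0] + g1.@[q 0] * (s2 i).@[q 0]) * h'.@[q 0] -
    (g0'.@[q 0] * (s1 i).@[q 0] + g1'.@[q 0] * (s2 i).@[q 0]) * h.@[q 0]).
    by rewrite mevalD !mevalM !mevalB !mevalM; ring.
  by rewrite hE subrr.
have [hp _] := E p Vp; have [hp' _] := E' p Vp'.
have ev a b : a * h' - b * h = 0 -> a.@[p 0] / h.@[p 0] = b.@[p 0] / h'.@[p 0].
  move=> /(congr1 (meval (p 0))); rewrite mevalB !mevalM meval0 => /eqP.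
  by rewrite subr_eq0 => /eqP ab; apply/eqP; rewrite eqr_div //; apply/eqP.
by apply/rowP; elim/ord2_ind; rewrite ?v0 ?v1 ?v0' ?v1'; apply: ev.
Qed.

Lemma germ_value t p v : germ t p v ->
  forall i, t p 0 i = v 0 0 * (s1 i).@[p 0] + v 0 1 * (s2 i).@[p 0].
Proof.
move=> [V [g0 [g1 [h [oV Vp E -> ->]]]]] i.
by have [hp ->] := E p Vp; rewrite mulrDl; congr (_ + _); rewrite mulrAC.
Qed.

(** After clearing denominators, [t] is a polynomial tuple orthogonal to the gradient on a nonempty
    open set, hence a syzygy, to which spanning applies. *)
Lemma syzygy_germ U t p : zariski_open U -> T_sheaf s U t -> U p ->
  exists V (g0 g1 h : S) e,
    [/\ zariski_open V, V p, (forall q, V q -> U q), fraction_on V t g0 g1 h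
      & [/\ h \is e.-homog, (d1 <= e)%N, (d2 <= e)%N,
            g0 \is (e - d1).-homog & g1 \is (e - d2).-homog]].
Proof.
move=> oU [tO tz] Up.
have [V [g [h [e [oV Vp VU [hh hg] E]]]]] := common_denominator tO Up.
have p0 : p != 0 by have [I [_ IU]] := oU; have [] := (IU p).1 Up.
have [j pj] := row_neq0_coord p0.
(* A power of a coordinate that does not vanish at [p] makes the degree of the
   numerators large enough for the division by the basis. *)
pose x : S := 'X_j ^+ (d1 + d2).
have hx : x \is (d1 + d2).-homog.
  by rewrite -[X in X.-homog]mul1n; apply: dhomogMn; rewrite dhomogX /= mdeg1.
have hV : zariski_open (fun q => V q /\ (q != 0 /\ x.@[q 0] != 0)).
  by apply: zariski_openI => //; apply: zariski_open_neq0 hx.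
have xp : x.@[p 0] != 0 by rewrite rmorphXn /= mevalXU expf_neq0.
have [||||a [b [ha hb gE]]] := syz_span basis (e := (e + (d1 + d2))%N) (g := fun i => g i * x).
- by rewrite addnCA leq_addr.
- by rewrite addnA leq_addl.
- by move=> i; apply: dhomogM.
- apply: (zariski_dense hV (p := p)) => [|q [Vq [_ xq]]]; first by [].
  have [hq tq] := E q Vq; apply: (mulfI hq); rewrite mulr0.
  transitivity (h.@[q 0] * h.@[q 0] * x.@[q 0] *
    \sum_(i < 3) t q 0 i * ((defining_equation s)^`M(i)).@[q 0]).
    rewrite /der raddf_sum [LHS]mulr_sumr [RHS]mulr_sumr; apply: eq_bigr => i _ /=.
    by rewrite tq !mevalM; field.
  by rewrite tz ?mulr0 //; apply: VU.
exists (fun q => V q /\ (q != 0 /\ x.@[q 0] != 0)), a, b, (h * x), (e + (d1 + d2))%N.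
split=> //; first by move=> q [/VU].
  move=> q [Vq [_ xq]]; have [hq tq] := E q Vq; split=> [|i].
    by rewrite mevalM mulf_neq0.
  by rewrite -!mevalM -mevalD -gE tq !mevalM -mulf_div divff // mulr1.
split=> //; first exact: dhomogM.
  by rewrite addnCA leq_addr.
by rewrite addnA leq_addl.
Qed.

Lemma fraction_germ V t g0 g1 h p : zariski_open V -> V p -> fraction_on V t g0 g1 h ->
  germ t p (\row_i if i == 0 then g0.@[p 0] / h.@[p 0] else g1.@[p 0] / h.@[p 0]).
Proof. by move=> oV Vp E; exists V, g0, g1, h; split=> //; rewrite mxE. Qed.

Lemma germ_exists U t p : zariski_open U -> T_sheaf s U t -> U p -> exists v, germ t p v.
Proof.
move=> oU tT Up; have [V [g0 [g1 [h [e [oV Vp _ E _]]]]]] := syzygy_germ oU tT Up.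
by eexists; apply: fraction_germ E.
Qed.

(** Chosen point by point, hence independent of the open set; 0 is a default where [t] has no
    germ. *)
Definition coordinates t p : 'rV[K]_2 :=
  if pselect (exists v, germ t p v) is left e then sval (cid e) else 0.

Lemma coordinates_germ U t p : zariski_open U -> T_sheaf s U t -> U p ->
  germ t p (coordinates t p).
Proof.
move=> oU tT Up; rewrite /coordinates; case: pselect => [e|[]].
  by case: cid.
exact: germ_exists Up.
Qed.

Lemma germ_unique1 t p v v' : germ t p v -> germ t p v' -> v = v'.
Proof.
move=> gv; have [V [_ [_ [_ [oV Vp _ _ _]]]]] := gv.
exact: (germ_unique oV Vp _ gv).
Qed.

Lemma germD t t' p v v' : germ t p v -> germ t' p v' ->
  germ (fun q => t q + t' q) p (v + v').
Proof.
move=> [V [g0 [g1 [h [oV Vp E v0 v1]]]]] [V' [g0' [g1' [h' [oV' Vp' E' v0' v1']]]]].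
have [hp _] := E p Vp; have [hp' _] := E' p Vp'.
exists (fun q => V q /\ V' q), (g0 * h' + g0' * h), (g1 * h' + g1' * h), (h * h').
split=> //.
- exact: zariski_openI.
- move=> q [Vq Vq']; have [hq tq] := E q Vq; have [hq' tq'] := E' q Vq'.
  split=> [|i]; first by rewrite mevalM mulf_neq0.
  by rewrite mxE tq tq' !(mevalD, mevalM); field; rewrite hq hq'.
- by rewrite mxE v0 v0' !(mevalD, mevalM); field; rewrite hp hp'.
- by rewrite mxE v1 v1' !(mevalD, mevalM); field; rewrite hp hp'.
Qed.

Lemma germZ U c t p v : section_O 0 U c -> U p -> germ t p v ->
  germ (fun q => c q *: t q) p (c p *: v).
Proof.
move=> cO Up [V [g0 [g1 [h [oV Vp E v0 v1]]]]].
have [V' [g [h' [d [e [oV' Vp' _ _ E']]]]]] := cO p Up.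
have [hp _] := E p Vp; have [hp' cp] := E' p Vp'.
exists (fun q => V q /\ V' q), (g * g0), (g * g1), (h' * h); split=> //.
- exact: zariski_openI.
- move=> q [Vq Vq']; have [hq tq] := E q Vq; have [hq' cq] := E' q Vq'.
  split=> [|i]; first by rewrite mevalM mulf_neq0.
  by rewrite mxE tq cq !mevalM; field; rewrite hq hq'.
- by rewrite mxE v0 cp !mevalM; field; rewrite hp hp'.
- by rewrite mxE v1 cp !mevalM; field; rewrite hp hp'.
Qed.

Lemma coordinates_sections U t : zariski_open U -> T_sheaf s U t ->
  sum_O [tuple - d1%:Z; - d2%:Z] U (coordinates t).
Proof.
move=> oU tT i p Up.
have [V [g0 [g1 [h [e [oV Vp VU E [hh d1e d2e hg0 hg1]]]]]]] := syzygy_germ oU tT Up.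
have cE q : V q -> coordinates t q =
    \row_i if i == 0 then g0.@[q 0] / h.@[q 0] else g1.@[q 0] / h.@[q 0].
  move=> Vq; apply: (@germ_unique1 t q); last exact: fraction_germ E.
  exact/(coordinates_germ oU tT)/VU.
elim/ord2_ind: i.
  exists V, g0, h, (e - d1)%N, e; split=> // [|q Vq].
    by split=> //; rewrite -subzn.
  by have [hq _] := E q Vq; rewrite cE // mxE.
exists V, g1, h, (e - d2)%N, e; split=> // [|q Vq].
  by split=> //; rewrite -subzn.
by have [hq _] := E q Vq; rewrite cE // mxE.
Qed.

(** The inverse of [coordinates] on sections. *)
Definition combination (t : 'rV[K]_3 -> 'rV[K]_2) p : 'rV[K]_3 :=
  \row_i (t p 0 0 * (s1 i).@[p 0] + t p 0 1 * (s2 i).@[p 0]).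

Lemma combination_fraction U t p : sum_O [tuple - d1%:Z; - d2%:Z] U t -> U p ->
  exists V (g0 g1 h : S) e,
    [/\ zariski_open V, V p, (forall q, V q -> U q),
        [/\ forall i, g0 * s1 i + g1 * s2 i \is e.-homog, h \is e.-homog,
            t p 0 0 = g0.@[p 0] / h.@[p 0] & t p 0 1 = g1.@[p 0] / h.@[p 0]]
      & fraction_on V (combination t) g0 g1 h].
Proof.
move=> tO Up.
have [V [g [h [d [e [oV Vp VU [hg hh de] E]]]]]] := tO 0 p Up.
have [V' [g' [h' [d' [e' [oV' Vp' VU' [hg' hh' de'] E']]]]]] := tO 1 p Up.
have {}de : (d + d1 = e)%N by apply/eqP; rewrite -eqz_nat PoszD de /= subrK.
have {}de' : (d' + d2 = e')%N by apply/eqP; rewrite -eqz_nat PoszD de' /= subrK.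
have [hp tp] := E p Vp; have [hp' tp'] := E' p Vp'.
exists (fun q => V q /\ V' q), (g * h'), (g' * h), (h * h'), (e + e')%N; split.
- exact: zariski_openI.
- by [].
- by move=> q [/VU].
- split.
  + move=> i; apply: rpredD.
      rewrite -de addnAC; apply: dhomogM (syz_homog1 basis i); exact: dhomogM.
    rewrite -de' addnA [X in (X + _)%N]addnC.
    by apply: dhomogM (syz_homog2 basis i); apply: dhomogM.
  + exact: dhomogM.
  + by rewrite tp !mevalM; field; rewrite hp hp'.
  + by rewrite tp' !mevalM; field; rewrite hp hp'.
move=> q [Vq Vq']; have [hq tq] := E q Vq; have [hq' tq'] := E' q Vq'.
split=> [|i]; first by rewrite mevalM mulf_neq0.
by rewrite mxE tq tq' !mevalM; field; rewrite hq hq'.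
Qed.

Lemma combination_syzygy U t : sum_O [tuple - d1%:Z; - d2%:Z] U t ->
  T_sheaf s U (combination t).
Proof.
move=> tO; split=> [i p Up|p Up].
  have [V [g0 [g1 [h [e [oV Vp VU [hg hh _ _] E]]]]]] := combination_fraction tO Up.
  exists V, (g0 * s1 i + g1 * s2 i), h, e, e; split=> //.
    by split=> //; elim/ord3_ind: i; rewrite /= addr0.
  move=> q Vq; have [hq tq] := E q Vq; split=> //.
  by rewrite tq mevalD !mevalM.
transitivity (t p 0 0 * (der s1 (defining_equation s)).@[p 0]
    + t p 0 1 * (der s2 (defining_equation s)).@[p 0]).
  rewrite /der !raddf_sum [X in X + _]mulr_sumr [X in _ + X]mulr_sumr -big_split /=.
  apply: eq_bigr => i _.
  by rewrite mxE !mevalM; ring.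
by rewrite (syz_der1 basis) (syz_der2 basis) meval0 !mulr0 addr0.
Qed.

(** The isomorphism is [coordinates]: uniqueness of germs gives naturality and linearity,
    [germ_value] injectivity, and [combination] surjectivity. *)
Lemma syzygy_basis_free : free_with_exponents s d1 d2.
Proof.
exists (fun=> coordinates); split.
  move=> U V t t' oU oV VU tT t'T tt' p Vp.
  apply: (germ_unique oV Vp (fun q Vq => tt' q Vq)).
    exact: coordinates_germ t'T Vp.
  exact: coordinates_germ tT (VU _ Vp).
move=> U oU; split.
- by move=> t; apply: coordinates_sections.
- move=> t t' tT t'T p Up.
  have gE := germD (coordinates_germ oU tT Up) (coordinates_germ oU t'T Up).
  (* The existence needed to unfold [coordinates] of the sum comes from the two germs directly, not
     from the sum being a section. *)
  apply: (germ_unique1 _ gE); rewrite /coordinates; case: pselect => [w|[]].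
    by case: cid.
  by eexists; apply: germD (coordinates_germ oU tT Up) (coordinates_germ oU t'T Up).
- move=> c t cO tT p Up.
  have gE := germZ cO Up (coordinates_germ oU tT Up).
  apply: (germ_unique1 _ gE); rewrite /coordinates; case: pselect => [w|[]].
    by case: cid.
  by eexists; apply: germZ cO Up (coordinates_germ oU tT Up).
- move=> t t' tT t'T tt' p Up; apply/rowP => i.
  rewrite (germ_value (coordinates_germ oU tT Up)).
  by rewrite (germ_value (coordinates_germ oU t'T Up)) tt'.
move=> t tO; have tT := combination_syzygy tO; exists (combination t) => // p Up.
apply: (germ_unique1 (coordinates_germ oU tT Up)).
have [V [g0 [g1 [h [e [oV Vp _ [_ _ t0 t1] E]]]]]] := combination_fraction tO Up.
by exists V, g0, g1, h; split.
Qed.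

End FreeSheaf.

(** * The arrangement *)

Section QProducts.
Variable R : comNzRingType.
Implicit Types q x y z : R.

(** A homogeneous q-Pochhammer symbol: [n] consecutive lines of a pencil, with slopes in geometric
    progression. *)
Definition qprod q n x y := \prod_(0 <= i < n) (x - q ^+ i * y).

Lemma qprod0 q x y : qprod q 0 x y = 1.
Proof. by rewrite /qprod big_geq. Qed.

Lemma qprodS q n x y : qprod q n.+1 x y = qprod q n x y * (x - q ^+ n * y).
Proof. by rewrite /qprod big_nat_recr. Qed.

Lemma qprod_add q m n x y :
  qprod q (m + n) x y = qprod q m x y * qprod q n x (q ^+ m * y).
Proof.
elim: n => [|n ih]; first by rewrite addn0 qprod0 mulr1.
by rewrite addnS !qprodS ih mulrA exprD [q ^+ n * _]mulrCA mulrA.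
Qed.

(* Ideal form of the q-Vandermonde identity
   [P_n (x, y) = \sum_j binom (n, j)_q P_j (x, z) P_(n-j) (z, y)]: when
   [k + l = n + 1], each term has [j >= k] or [n - j >= l]. *)
Lemma qprod_ideal q x y z n k l : (k + l)%N = n.+1 ->
  exists a b, qprod q n x y = qprod q k x z * a + qprod q l z y * b.
Proof.
elim: n k l => [|n ih] [|k] [|l] // kl;
  try by [exists (qprod q n.+1 x y), 0; rewrite qprod0 mulr0 addr0 mul1r
         |exists 0, (qprod q n.+1 x y); rewrite qprod0 mulr0 add0r mul1r
         |exists 1, 0; rewrite !qprod0 mulr0 addr0 mul1r
         |exists 0, 1; rewrite !qprod0 mulr0 add0r mul1r].
  by move: kl; rewrite addnS.
have kln : (k + l)%N = n by move: kl; rewrite addSn addnS => -[].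
have [a [b abE]] := ih k.+1 l (congr1 S kln).
have [a' [b' abE']] := ih k l.+1 (etrans (addnS k l) (congr1 S kln)).
(* With [n = k + l], the new factor splits as [x - q^n y = (x - q^k z) + q^k (z - q^l y)]; each part
   lengthens one of the two products. *)
exists (a' + q ^+ k * (z - q ^+ l * y) * a), ((x - q ^+ k * z) * b' + q ^+ k * b).
rewrite [LHS]qprodS -kln exprD.
transitivity ((x - q ^+ k * z) * qprod q (k + l) x y
   + q ^+ k * (z - q ^+ l * y) * qprod q (k + l) x y); first by ring.
by rewrite {1}kln abE' kln abE !qprodS; ring.
Qed.

(** Transfers univariate factorizations, such as that of ['X^N - 1], to binary forms. *)
Lemma homogenized_prod (a : nat -> R) n x y :
  \prod_(0 <= i < n) (x - a i * y) =
  \sum_(j < n.+1) (\prod_(0 <= i < n) ('X - (a i)%:P))`_j * (x ^+ j * y ^+ (n - j)).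
Proof.
elim: n => [|n ih].
  by rewrite !big_geq // big_ord1 coef1 !expr0 !mulr1.
rewrite !big_nat_recr //= ih; set p := \prod_(0 <= i < n) _.
have pn : p`_n.+1 = 0.
  by apply: nth_default; rewrite size_prod_XsubC size_iota subn0.
under [RHS]eq_bigr => j _ do rewrite mulrBr coefB coefMX coefMC mulrBl.
rewrite sumrB mulrBr; congr (_ - _).
  rewrite [RHS]big_ord_recl mul0r add0r mulr_suml; apply: eq_bigr => j _.
  by rewrite /= subSS exprS; ring.
rewrite [RHS]big_ord_recr /= pn !mul0r addr0 mulr_suml; apply: eq_bigr => j _.
by rewrite /= subSn ?leq_ord // exprS; ring.
Qed.

End QProducts.

(** * Complete pencils from roots of unity *)

Section RootsOfUnity.
Variable K : numFieldType.
Local Notation S := {mpoly K[3]}.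
Implicit Types (x y : S) (q : K).

Lemma qprod_unity q N x y : N.-primitive_root q ->
  qprod q%:MP N x y = x ^+ N - y ^+ N.
Proof.
move=> qN; have N0 := prim_order_gt0 qN.
rewrite /qprod; under eq_bigr do rewrite -rmorphXn.
rewrite homogenized_prod.
have -> : \prod_(0 <= i < N) ('X - (((q ^+ i)%:MP : S)%:P)) = 'X^N - 1.
  have := congr1 (map_poly (@mpolyC 3 K)) (factor_Xn_sub_1 qN).
  rewrite rmorph_prod rmorphB /= map_polyXn rmorph1 => <-.
  by apply: eq_bigr => i _; rewrite rmorphB /= map_polyX map_polyC.
under eq_bigr => j _ do rewrite coefB coefXn coef1 mulrBl.
rewrite sumrB (bigD1 ord_max) //= ?eqxx mul1r subnn mulr1 big1 ?addr0 => [|j jN] //.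
  congr (_ - _); rewrite (bigD1 ord0) //= ?eqxx !mul1r subn0 big1 ?addr0 // => j j0.
  rewrite (_ : (j == 0 :> nat)%N = false) ?mul0r //.
  by apply: contraNF j0 => /eqP ?; apply/eqP/val_inj.
rewrite (_ : (j == N :> nat)%N = false) ?mul0r //.
by apply: contraNF jN => /eqP ?; apply/eqP/val_inj.
Qed.

Lemma qprod_unity_scaled q N c x y : N.-primitive_root q -> c ^+ N = 1 ->
  qprod q%:MP N x (c%:MP * y) = x ^+ N - y ^+ N.
Proof.
by move=> qN cN; rewrite qprod_unity // exprMn -rmorphXn cN rmorph1 mul1r.
Qed.

Lemma qprod_dvd (q : S) n i x y : (i < n)%N -> mdvd (x - q ^+ i * y) (qprod q n x y).
Proof.
move=> lt_in; rewrite /qprod (bigD1_seq i) ?mem_index_iota ?iota_uniq //=.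
by eexists.
Qed.

End RootsOfUnity.

(** * Coordinates adapted to the vertices *)

Section Frame.
Variable K : numFieldType.
Local Notation S := {mpoly K[3]}.
Variables A B C : 'rV[K]_3.
Hypothesis hABC : non_aligned A B C.

Lemma on_lineE (l p : 'rV[K]_3) : on_line l p = (\sum_i l 0 i * p 0 i == 0).
Proof. by rewrite /on_line meval_linear_form. Qed.

Definition frame : 'M[K]_3 :=
  \matrix_(i, j) (if i == 0 then A 0 j else if i == 1 then B 0 j else C 0 j).

(** A nonzero vector orthogonal to the rows would be a line through all three points. *)
Lemma frame_unit : frame \in unitmx.
Proof.
rewrite -unitmx_tr -row_free_unit -kermx_eq0; apply/negPn/negP => /rowV0Pn[l].
move=> /sub_kermxP l0 /hABC; rewrite !on_lineE.
have lE i : \sum_j l 0 j * frame i j = 0.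
  transitivity ((l *m frame^T) 0 i); last by rewrite l0 mxE.
  by rewrite [RHS]mxE; apply: eq_bigr => j _; rewrite [frame^T _ _]mxE.
by have := (lE 0, lE 1, lE 2) => -[[]]; rewrite !sum_ord3 !mxE /= => -> -> ->; rewrite eqxx.
Qed.

Definition vec3 (u v w : K) : 'rV[K]_3 := \row_i (if i == 0 then u else if i == 1 then v else w).

(* The line with equation [u x + v y + w z = 0] in the coordinates for which
   [A], [B], [C] are the coordinate points. *)
Definition line (u v w : K) : 'rV[K]_3 := vec3 u v w *m (invmx frame)^T.

Lemma line_frame u v w i :
  \sum_j line u v w 0 j * frame i j = if i == 0 then u else if i == 1 then v else w.
Proof.
transitivity ((line u v w *m frame^T) 0 i).
  by rewrite [RHS]mxE; apply: eq_bigr => j _; rewrite [frame^T _ _]mxE.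
by rewrite /line -mulmxA -trmx_mul mulmxV ?frame_unit // trmx1 mulmx1 mxE.
Qed.

Lemma line_A u v w : \sum_j line u v w 0 j * A 0 j = u.
Proof.
apply: etrans (line_frame u v w 0).
by apply: eq_bigr => j _; rewrite [frame _ _]mxE.
Qed.

Lemma line_B u v w : \sum_j line u v w 0 j * B 0 j = v.
Proof.
apply: etrans (line_frame u v w 1).
by apply: eq_bigr => j _; rewrite [frame _ _]mxE.
Qed.

Lemma line_C u v w : \sum_j line u v w 0 j * C 0 j = w.
Proof.
apply: etrans (line_frame u v w 2).
by apply: eq_bigr => j _; rewrite [frame _ _]mxE.
Qed.

Lemma on_line_vertices u v w : (on_line (line u v w) A = (u == 0)) *
  (on_line (line u v w) B = (v == 0)) * (on_line (line u v w) C = (w == 0)).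
Proof. by rewrite !on_lineE line_A line_B line_C. Qed.

Lemma line_minors u v w u' v' w' : (line u v w <= line u' v' w')%MS ->
  [/\ u * v' = u' * v, v * w' = v' * w & u * w' = u' * w].
Proof.
case/sub_rVP => c lE.
have e (p : 'rV[K]_3) : \sum_j line u v w 0 j * p 0 j = c * \sum_j line u' v' w' 0 j * p 0 j.
  by rewrite lE mulr_sumr; apply: eq_bigr => j _; rewrite mxE mulrA.
have := (e A, e B, e C); rewrite !line_A !line_B !line_C => -[[-> ->] ->].
by split; ring.
Qed.

Lemma line_eq0 u v w : (line u v w == 0) = [&& u == 0, v == 0 & w == 0].
Proof.
apply/eqP/and3P => [l0|[/eqP-> /eqP-> /eqP->]].
  have e (p : 'rV[K]_3) : \sum_j line u v w 0 j * p 0 j = 0.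
    by rewrite l0 big1 // => j _; rewrite mxE mul0r.
  by have := (e A, e B, e C); rewrite line_A line_B line_C => -[[-> ->] ->].
rewrite /line (_ : vec3 0 0 0 = 0) ?mul0mx //.
by apply/rowP => i; rewrite !mxE; do 2?case: ifP.
Qed.

Let x := linear_form (line 1 0 0).
Let y := linear_form (line 0 1 0).
Let z := linear_form (line 0 0 1).

Lemma linear_form_line u v w :
  linear_form (line u v w) = u%:MP * x + v%:MP * y + w%:MP * z.
Proof.
rewrite !mul_mpolyC -!linear_formZ -!linear_formD; congr linear_form.
rewrite /line !scalemxAl -!mulmxDl; congr (_ *m _).
by apply/rowP; elim/ord3_ind; rewrite !mxE /=; ring.
Qed.

(** The vector field taking the coordinates [x], [y], [z] dual to [A], [B], [C] to [p], [q], [r]. *)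
Definition field_of (p q r : S) : 'I_3 -> S :=
  fun j => p * (A 0 j)%:MP + q * (B 0 j)%:MP + r * (C 0 j)%:MP.

Lemma der_field_of p q r u v w :
  der (field_of p q r) (linear_form (line u v w)) = u%:MP * p + v%:MP * q + w%:MP * r.
Proof.
rewrite der_linear_form -[in RHS](line_A u v w) -[X in _ + X%:MP * _ + _](line_B u v w).
rewrite -[X in _ + X%:MP * _](line_C u v w) !raddf_sum /= !mulr_suml -!big_split /=.
by apply: eq_bigr => j _; rewrite -mul_mpolyC !mpolyCM /field_of; ring.
Qed.

Lemma euler_field_of : euler K =1 field_of x y z.
Proof.
move=> i; transitivity (\sum_k ((invmx frame *m frame) k i)%:MP * 'X_k : S).
  rewrite mulVmx ?frame_unit // (bigD1 i) //= mxE eqxx mpolyC1 mul1r big1 ?addr0 //.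
  by move=> j /negPf ji; rewrite mxE ji mpolyC0 mul0r.
rewrite /field_of /x /y /z /linear_form !mulr_suml -!big_split /=; apply: eq_bigr => k _.
rewrite [(invmx frame *m frame) _ _]mxE sum_ord3 ![frame _ _]mxE /= !mpolyCD !mpolyCM -!mul_mpolyC.
have lE u v w : line u v w 0 k = u * invmx frame k 0 + v * invmx frame k 1 + w * invmx frame k 2.
  by rewrite mxE sum_ord3 !mxE.
by rewrite !lE !(mul0r, mul1r, add0r, addr0); ring.
Qed.

Lemma det3_mul (R : comNzRingType) (m n : 'I_3 -> 'I_3 -> R) :
  det3 (fun j => m 0 0 * n 0 j + m 0 1 * n 1 j + m 0 2 * n 2 j)
       (fun j => m 1 0 * n 0 j + m 1 1 * n 1 j + m 1 2 * n 2 j)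
       (fun j => m 2 0 * n 0 j + m 2 1 * n 1 j + m 2 2 * n 2 j) =
  det3 (m 0) (m 1) (m 2) * det3 (n 0) (n 1) (n 2).
Proof. by rewrite /det3; ring. Qed.

Lemma det3_frame_neq0 : det3 (A 0) (B 0) (C 0) != 0.
Proof.
pose g := invmx frame.
have fE i j : frame i 0 * g 0 j + frame i 1 * g 1 j + frame i 2 * g 2 j = (i == j)%:R.
  transitivity ((frame *m g) i j); first by rewrite [RHS]mxE sum_ord3.
  by rewrite mulmxV ?frame_unit // mxE.
have := det3_mul frame g; rewrite /det3 !fE /= => /esym.
rewrite !(mulr0, mul0r, mulr1, subr0, addr0) => /eqP.
apply: contraTneq => D0; move: D0; rewrite !mxE /= => ->.
by rewrite mul0r eq_sym oner_eq0.
Qed.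

Lemma det3_field_of p q r p' q' r' :
  det3 (euler K) (field_of p q r) (field_of p' q' r') =
  det3 (A 0) (B 0) (C 0) *:
    (x * (q * r' - r * q') - y * (p * r' - r * p') + z * (p * q' - q * p')).
Proof.
rewrite -mul_mpolyC /det3 !euler_field_of /field_of !(mpolyCD, mpolyCB, mpolyCM).
by ring.
Qed.

End Frame.

(** * The arrangement, its cofactors and its freeness *)

Section Construction.
Variable K : numFieldType.
Local Notation S := {mpoly K[3]}.
Variables A B C : 'rV[K]_3.
Hypothesis hABC : non_aligned A B C.

Local Notation line := (line A B C).
Local Notation x := (linear_form (line 1 0 0)).
Local Notation y := (linear_form (line 0 1 0)).
Local Notation z := (linear_form (line 0 0 1)).

Lemma line_neqmx u v w u' v' w' :
  [|| u * v' != u' * v, v * w' != v' * w | u * w' != u' * w] ->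
  ~~ (line u v w == line u' v' w')%MS.
Proof.
by apply: contraL => /andP[/(line_minors hABC)[-> -> ->] _]; rewrite !eqxx.
Qed.

Lemma linear_form_lineC c : linear_form (line 1 (- c) 0) = x - c%:MP * y.
Proof. by rewrite linear_form_line mpolyC1 mpolyC0 mpolyCN; ring. Qed.

Lemma linear_form_lineA c : linear_form (line 0 (- c) 1) = z - c%:MP * y.
Proof. by rewrite linear_form_line mpolyC1 mpolyC0 mpolyCN; ring. Qed.

Lemma linear_form_lineB c : linear_form (line 1 0 (- c)) = x - c%:MP * z.
Proof. by rewrite linear_form_line mpolyC1 mpolyC0 mpolyCN; ring. Qed.

Lemma dhomog_field_of d p r t : p \is d.-homog -> r \is d.-homog -> t \is d.-homog ->
  forall i, field_of A B C p r t i \is d.-homog.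
Proof.
move=> hp hr ht i; rewrite /field_of ![_ * _%:MP]mulrC !mul_mpolyC.
by rewrite !rpredD ?rpredZ.
Qed.

Variables (q : K).
Hypothesis q0 : q != 0.
Local Notation Q := (q%:MP : S).

(** The letter names the vertex through which the lines pass; [a] is the first exponent of [q]. *)
Definition linesC a n := [seq line 1 (- q ^+ (a + i)) 0 | i <- index_iota 0 n].
Definition linesA a n := [seq line 0 (- q ^+ (a + i)) 1 | i <- index_iota 0 n].
Definition linesB a n := [seq line 1 0 (- q ^+ (a + i)) | i <- index_iota 0 n].

Lemma expq_factor a i (u v : S) : u - (q ^+ (a + i))%:MP * v = u - Q ^+ i * (Q ^+ a * v).
Proof. by rewrite rmorphXn exprD /=; ring. Qed.

Lemma defining_equation_linesC a n :
  defining_equation (linesC a n) = qprod Q n x (Q ^+ a * y).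
Proof.
rewrite /defining_equation big_map; apply: eq_bigr => i _.
by rewrite linear_form_lineC expq_factor.
Qed.

Lemma defining_equation_linesA a n :
  defining_equation (linesA a n) = qprod Q n z (Q ^+ a * y).
Proof.
rewrite /defining_equation big_map; apply: eq_bigr => i _.
by rewrite linear_form_lineA expq_factor.
Qed.

Lemma defining_equation_linesB a n :
  defining_equation (linesB a n) = qprod Q n x (Q ^+ a * z).
Proof.
rewrite /defining_equation big_map; apply: eq_bigr => i _.
by rewrite linear_form_lineB expq_factor.
Qed.

Lemma mem_linesC a n l : l \in linesC a n ->
  exists2 c, c != 0 & l = line 1 (- c) 0.
Proof. by case/mapP => i _ ->; eexists; last by []; rewrite expf_neq0. Qed.

Lemma mem_linesA a n l : l \in linesA a n ->
  exists2 c, c != 0 & l = line 0 (- c) 1.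
Proof. by case/mapP => i _ ->; eexists; last by []; rewrite expf_neq0. Qed.

Lemma mem_linesB a n l : l \in linesB a n ->
  exists2 c, c != 0 & l = line 1 0 (- c).
Proof. by case/mapP => i _ ->; eexists; last by []; rewrite expf_neq0. Qed.

Lemma linesC_neq0 a n : all (fun l => l != 0) (linesC a n).
Proof. by rewrite all_map; apply/allP => i _ /=; rewrite (line_eq0 hABC) oner_eq0. Qed.

Lemma linesA_neq0 a n : all (fun l => l != 0) (linesA a n).
Proof. by rewrite all_map; apply/allP => i _ /=; rewrite (line_eq0 hABC) oner_eq0 !andbF. Qed.

Lemma linesB_neq0 a n : all (fun l => l != 0) (linesB a n).
Proof. by rewrite all_map; apply/allP => i _ /=; rewrite (line_eq0 hABC) oner_eq0. Qed.

Variable N : nat.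
Hypothesis qN : N.-primitive_root q.

Lemma pairwise_index_iota (r : rel nat) n :
  (forall i j, (i < n)%N -> (j < n)%N -> i != j -> r i j) -> pairwise r (index_iota 0 n).
Proof.
move=> rP; apply/(@sub_in_pairwise _ [pred i | (i < n)%N] [rel i j | i != j]).
- by move=> i j; rewrite !inE; apply: rP.
- by apply/allP => i; rewrite mem_index_iota.
by rewrite -uniq_pairwise iota_uniq.
Qed.

Lemma expq_neq a n i j : (n <= N)%N -> (i < n)%N -> (j < n)%N -> i != j ->
  q ^+ (a + i) != q ^+ (a + j).
Proof.
move=> nN lt_in lt_jn ij; rewrite (eq_prim_root_expr qN) eqn_modDl.
by rewrite !modn_small // (leq_trans _ nN).
Qed.

Local Notation distinct := (pairwise (fun l l' : 'rV[K]_3 => ~~ (l == l')%MS)).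

Lemma linesC_distinct a n : (n <= N)%N -> distinct (linesC a n).
Proof.
move=> nN; rewrite pairwise_map; apply: pairwise_index_iota => i j ni nj ij.
by apply: line_neqmx; rewrite !mul1r eqr_opp eq_sym (expq_neq a nN).
Qed.

Lemma linesA_distinct a n : (n <= N)%N -> distinct (linesA a n).
Proof.
move=> nN; rewrite pairwise_map; apply: pairwise_index_iota => i j ni nj ij.
by apply: line_neqmx; rewrite !mulr1 eqr_opp (expq_neq a nN) ?orbT.
Qed.

Lemma linesB_distinct a n : (n <= N)%N -> distinct (linesB a n).
Proof.
move=> nN; rewrite pairwise_map; apply: pairwise_index_iota => i j ni nj ij.
by apply: line_neqmx; rewrite !mul1r eqr_opp (expq_neq a nN nj ni) ?orbT // eq_sym.
Qed.

(** The removed exponents are [0..k-1] at [C] and [B], and [k..2k-1] at [A]. Three removed lines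
    would meet only if [l = i + j + k] modulo [N] with [i, j, l < k], which [3k <= N] excludes. *)
Definition triangle k m := [:: line 1 0 0; line 0 1 0; line 0 0 1] ++
  linesC k m ++ linesA (k + k) m ++ linesB k m.

Lemma size_triangle k m : size (triangle k m) = (3 * m.+1)%N.
Proof. by rewrite /= !size_cat !size_map !size_iota; lia. Qed.

Lemma defining_equation_triangle k m : defining_equation (triangle k m) =
  x * y * z * (qprod Q m x (Q ^+ k * y) * qprod Q m z (Q ^+ (k + k) * y)
    * qprod Q m x (Q ^+ k * z)).
Proof.
rewrite -defining_equation_linesC -defining_equation_linesA -defining_equation_linesB.
by rewrite /defining_equation /triangle !big_cat !big_cons big_nil /= mulr1 !mulrA.
Qed.

Lemma triangle_arrangement k m : (m <= N)%N -> line_arrangement (triangle k m).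
Proof.
move=> mN; have e1 : (1 == 0 :> K) = false := oner_eq0 K.
have e1' : (0 == 1 :> K) = false by rewrite eq_sym e1.
pose simp := (mul0r, mul1r, mulr0, mulr1, mulNr, mulrN, oppr0, oppr_eq0, eqxx, e1, e1', orbT).
apply/andP; split.
  rewrite !all_cat linesC_neq0 linesA_neq0 linesB_neq0 /= !andbT.
  by rewrite !(line_eq0 hABC) e1 !andbF.
rewrite /triangle pairwise_cat; apply/and3P; split.
- apply/allrelP => l l'; rewrite !inE !mem_cat.
  by move=> /or3P[] /eqP -> /or3P[/mem_linesC|/mem_linesA|/mem_linesB] [c /negPf c0 ->];
    apply: line_neqmx; rewrite ?simp ?[0 == - c]eq_sym ?simp ?c0.
- by rewrite /= ?andbT; do !(apply/andP; split); apply: line_neqmx; rewrite ?simp.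
rewrite pairwise_cat linesC_distinct //= pairwise_cat linesA_distinct // linesB_distinct //.
rewrite !andbT; apply/andP; split; apply/allrelP => l l'.
  case/mem_linesC => c /negPf c0 ->; rewrite mem_cat => /orP[].
    case/mem_linesA => c' /negPf c'0 ->.
    by apply: line_neqmx; rewrite ?simp ?c0 ?c'0 /= ?orbT.
  case/mem_linesB => c' /negPf c'0 ->.
  by apply: line_neqmx; rewrite ?simp ?c0 ?c'0 /= ?orbT.
case/mem_linesA => c /negPf c0 -> /mem_linesB[c' /negPf c'0 ->].
by apply: line_neqmx; rewrite ?simp ?c0 ?c'0 /= ?orbT.
Qed.

Lemma count_lines (f : nat -> 'rV[K]_3) (p : 'rV[K]_3) b n :
  (forall i, on_line (f i) p = b) ->
  count (fun l => on_line l p) [seq f i | i <- index_iota 0 n] = (b * n)%N.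
Proof.
move=> fb; rewrite count_map (eq_count (a2 := fun=> b)) => [|i]; last exact: fb.
case: b fb => _; rewrite ?count_predT ?count_pred0 // size_iota subn0 mul1n //.
Qed.

Lemma triangle_Tr k m : (m <= N)%N -> Tr A B C m.+1 m.+1 m.+1 (triangle k m).
Proof.
move=> mN; rewrite /Tr triangle_arrangement //=.
have vE := on_line_vertices hABC.
have c0 i : (- q ^+ i == 0) = false by rewrite oppr_eq0 expf_eq0 (negPf q0) andbF.
have cnt f p b := @count_lines f p b m.
rewrite !vE eqxx oner_eq0 /= !all_cat !all_map !count_cat.
rewrite (cnt _ A false) => [|i]; last by rewrite vE oner_eq0.
rewrite (cnt _ A true) => [|i]; last by rewrite vE eqxx.
rewrite (cnt _ A false) => [|i]; last by rewrite vE oner_eq0.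
rewrite (cnt _ B false) => [|i]; last by rewrite vE c0.
rewrite (cnt _ B false) => [|i]; last by rewrite vE c0.
rewrite (cnt _ B true) => [|i]; last by rewrite vE eqxx.
rewrite (cnt _ C true) => [|i]; last by rewrite vE eqxx.
rewrite (cnt _ C false) => [|i]; last by rewrite vE oner_eq0.
rewrite (cnt _ C false) => [|i]; last by rewrite vE c0.
rewrite !mul0n !mul1n !add0n !addn0 !add1n !eqxx !andbT.
by apply/and3P; split; apply/allP => i _; rewrite /= !vE eqxx ?orbT.
Qed.

Lemma logarithmic_triangle k m (p r t : S) :
  mdvd x p -> mdvd y r -> mdvd z t ->
  (forall i, (i < m)%N -> mdvd (x - (q ^+ (k + i))%:MP * y) (p - (q ^+ (k + i))%:MP * r)) ->
  (forall i, (i < m)%N ->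
    mdvd (z - (q ^+ (k + k + i))%:MP * y) (t - (q ^+ (k + k + i))%:MP * r)) ->
  (forall i, (i < m)%N -> mdvd (x - (q ^+ (k + i))%:MP * z) (p - (q ^+ (k + i))%:MP * t)) ->
  logarithmic (field_of A B C p r t) (triangle k m).
Proof.
move=> xp yr zt hC hA hB l; rewrite /triangle !mem_cat => /or4P[].
- rewrite !inE => /or3P[] /eqP ->; rewrite der_field_of // !mpolyC1 !mpolyC0.
  + by rewrite !mul0r !addr0 mul1r.
  + by rewrite !mul0r add0r addr0 mul1r.
  by rewrite !mul0r !add0r mul1r.
- case/mapP => i; rewrite mem_index_iota => /andP[_ im] ->.
  rewrite der_field_of // linear_form_lineC mpolyC1 mpolyC0 mpolyCN mul0r addr0 mul1r mulNr.
  exact: hC.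
- case/mapP => i; rewrite mem_index_iota => /andP[_ im] ->.
  rewrite der_field_of // linear_form_lineA mpolyC1 mpolyC0 mpolyCN mul0r add0r mul1r mulNr.
  by rewrite [X in mdvd _ X]addrC; apply: hA.
case/mapP => i; rewrite mem_index_iota => /andP[_ im] ->.
rewrite der_field_of // linear_form_lineB mpolyC1 mpolyC0 mpolyCN mul0r addr0 mul1r mulNr.
exact: hB.
Qed.

Lemma dhomog_scaled (c : S) d (p : S) : c \is 0.-homog -> p \is d.-homog -> c * p \is d.-homog.
Proof. by move=> hc hp; rewrite -[d]add0n; apply: dhomogM. Qed.

Lemma dhomog_expQ i : Q ^+ i \is 0.-homog.
Proof. by rewrite -rmorphXn /= -[_%:MP]mulr1 mul_mpolyC rpredZ ?dhomog1. Qed.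

Lemma dhomog_qprod n (u v : S) : u \is 1.-homog -> v \is 1.-homog ->
  qprod Q n u v \is n.-homog.
Proof.
move=> hu hv; elim: n => [|n ih]; first by rewrite qprod0 dhomog1.
rewrite qprodS -(addn1 n); apply: dhomogM => //.
by rewrite rpredB // dhomog_scaled ?dhomog_expQ.
Qed.

Lemma complete_pencils k m : (m + k)%N = N ->
  [/\ qprod Q k x y * qprod Q m x (Q ^+ k * y) = x ^+ N - y ^+ N,
      qprod Q k z (Q ^+ k * y) * qprod Q m z (Q ^+ (k + k) * y) = z ^+ N - y ^+ N
    & qprod Q k x z * qprod Q m x (Q ^+ k * z) = x ^+ N - z ^+ N].
Proof.
move=> mkN; rewrite exprD -[Q ^+ k * Q ^+ k * y]mulrA -!qprod_add addnC mkN -rmorphXn.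
split; [exact: qprod_unity | | exact: qprod_unity].
by apply: qprod_unity_scaled; rewrite // exprAC (prim_expr_order qN) expr1n.
Qed.

(* The first relation is an instance of Max Noether's theorem: the lines of [h1]
   pass through the [k^2] points where the lines of [g2] and [g3] meet. The form
   [c] comes from dividing [g2 (g1 b - h2) = g3 (h3 - g1 a)], which holds because
   [g1 h1 = g2 h2 + g3 h3]. *)
Lemma triangle_cofactors k m : (m + k)%N = N -> (k + k <= m)%N ->
  let g1 := qprod Q k x y in let h1 := qprod Q m x (Q ^+ k * y) in
  let g2 := qprod Q k z (Q ^+ k * y) in let h2 := qprod Q m z (Q ^+ (k + k) * y) in
  let g3 := qprod Q k x z in let h3 := qprod Q m x (Q ^+ k * z) in
  exists a b c : S, [/\ a \is (m - k).-homog, b \is (m - k).-homog, c \is (m - k).-homog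
    & [/\ h1 = g2 * b + g3 * a, h2 = g1 * b - g3 * c & h3 = g1 * a + g2 * c]].
Proof.
move=> mkN km g1 h1 g2 h2 g3 h3.
have hx := dhomog_linear_form (line 1 0 0).
have hy := dhomog_linear_form (line 0 1 0).
have hz := dhomog_linear_form (line 0 0 1).
have hQy i : Q ^+ i * y \is 1.-homog by rewrite dhomog_scaled ?dhomog_expQ.
have hg1 : g1 \is k.-homog by apply: dhomog_qprod.
have hg2 : g2 \is k.-homog by apply: dhomog_qprod.
have hg3 : g3 \is k.-homog by apply: dhomog_qprod.
have hh1 : h1 \is m.-homog by apply: dhomog_qprod.
have hh2 : h2 \is m.-homog by apply: dhomog_qprod.
have le_km : (k <= m)%N := leq_trans (leq_addr k k) km.
have [a [b [ha hb E1]]] : exists a b : S,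
    [/\ a \is (m - k).-homog, b \is (m - k).-homog & h1 = g2 * b + g3 * a].
  (* Only the first [k + k] lines of [h1] are used, the others forming [e]. The two lengths must add
     up to [k + k + 1], so one is [k + 1], its extra line going into the cofactor; this also covers
     [k = 0]. *)
  have [a0 [b0 abE]] := qprod_ideal Q x (Q ^+ k * y) z (addnS k k).
  pose e := qprod Q (m - (k + k)) x (Q ^+ (k + k) * (Q ^+ k * y)).
  have {abE}h1E : h1 = g2 * ((z - Q ^+ k * (Q ^+ k * y)) * b0 * e) + g3 * (a0 * e).
    by rewrite {1}/h1 -(subnKC km) qprod_add abE qprodS /e /g2 /g3; ring.
  (* As [h1], [g2] and [g3] are homogeneous, the relation persists for the components of degree
     [m - k] of the cofactors. *)
  exists (pihomog mdeg (m - k) (a0 * e)),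
    (pihomog mdeg (m - k) ((z - Q ^+ k * (Q ^+ k * y)) * b0 * e)).
  split; rewrite ?pihomogP // -(pihomogM _ _ hg2) -(pihomogM _ _ hg3) subnKC // -pihomogD.
  by rewrite -h1E pihomog_dE.
have [gh1 gh2 gh3] := complete_pencils mkN.
rewrite -/g1 -/h1 -/g2 -/h2 -/g3 -/h3 in gh1 gh2 gh3.
have syz : g2 * (g1 * b - h2) = g3 * (h3 - g1 * a).
  apply/eqP; rewrite -subr_eq0; apply/eqP.
  transitivity (g1 * (g2 * b + g3 * a) - g2 * h2 - g3 * h3); first by ring.
  by rewrite -E1 gh1 gh2 gh3; ring.
have kN : (k <= N)%N by rewrite -mkN leq_addl.
have g2E : g2 = defining_equation (linesA k k) by rewrite defining_equation_linesA.
have g3E : g3 = defining_equation (linesB 0 k).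
  by rewrite defining_equation_linesB expr0 mul1r.
have [c cE] : mdvd g3 (g1 * b - h2).
  rewrite g3E; apply: defining_equation_dvd.
    by rewrite /line_arrangement linesB_neq0 linesB_distinct.
  move=> l l3; have l0 := allP (linesB_neq0 0 k) _ l3.
  (* The lines of [g3] pass through [B] but not [A], those of [g2] through [A] but not [B], so [g2]
     cancels. *)
  apply: (@line_prime_prod _ l (linesA k k)) => //.
    apply/allP => l' l2; rewrite (allP (linesA_neq0 k k) _ l2) /=.
    have [c /negPf c0 ->] := mem_linesB l3; have [c' /negPf c'0 ->] := mem_linesA l2.
    by apply: line_neqmx; rewrite mul1r mul0r oppr_eq0 c'0.
  rewrite -g2E mulrC syz; apply: mdvd_mulr.
  rewrite g3E; have := perm_to_rem l3 => /(perm_big _) gE.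
  by rewrite /defining_equation gE big_cons; eexists.
have g3n0 : g3 != 0 by rewrite g3E defining_equation_neq0 ?linesB_neq0.
exists a, b, c; split=> //.
  apply: (dhomog_quotient g3n0 hg3); rewrite -cE subnKC // rpredB //.
  by rewrite -(subnKC le_km); apply: dhomogM.
split=> //; first by rewrite -cE; ring.
apply: (mulfI g3n0).
transitivity (g3 * (h3 - g1 * a) + g3 * (g1 * a)); first by ring.
by rewrite -syz cE; ring.
Qed.

Lemma triangle_free k m : (m + k)%N = N -> (k + k <= m)%N ->
  free_with_exponents (triangle k m) (m + k).+1%N%:Z (m + m - k).+1%N%:Z.
Proof.
move=> mkN km.
(* The right side is the degree of [x * g2 * b * c], factor by factor. *)
have degE : (m + m - k).+1 = (1 + k + (m - k) + (m - k))%N by lia.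
have sizeE : (3 * m.+1)%N = ((m + k).+1 + (m + m - k).+1).+1 by lia.
have [a [b [c [ha hb hc [E1 E2 E3]]]]] := triangle_cofactors mkN km.
have le_km : (k <= m)%N := leq_trans (leq_addr k k) km.
set g1 := qprod Q k x y in E1 E2 E3; set g2 := qprod Q k z _ in E1 E2 E3.
set g3 := qprod Q k x z in E1 E2 E3.
set h1 := qprod Q m x _ in E1; set h2 := qprod Q m z _ in E2; set h3 := qprod Q m x _ in E3.
have hx := dhomog_linear_form (line 1 0 0).
have hy := dhomog_linear_form (line 0 1 0).
have hz := dhomog_linear_form (line 0 0 1).
have hg1 : g1 \is k.-homog by apply: dhomog_qprod.
have hg2 : g2 \is k.-homog by apply: dhomog_qprod; rewrite ?dhomog_scaled ?dhomog_expQ.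
have hg3 : g3 \is k.-homog by apply: dhomog_qprod.
have [gh1 gh2 gh3] := complete_pencils mkN.
rewrite -/g1 -/h1 -/g2 -/h2 -/g3 -/h3 in gh1 gh2 gh3.
(* Since [q^i] is an [N]-th root of unity, it equals its own power of exponent [N + 1]. *)
have pow (u v : S) i : mdvd (u - (q ^+ i)%:MP * v) (u ^+ N.+1 - (q ^+ i)%:MP * v ^+ N.+1).
  have -> : (q ^+ i)%:MP * v ^+ N.+1 = ((q ^+ i)%:MP * v) ^+ N.+1.
    rewrite exprMn -rmorphXn /=; congr (_%:MP * _).
    by rewrite exprSr exprAC (prim_expr_order qN) expr1n mul1r.
  by rewrite subrXX; eexists.
have dvd_h (u v : S) l i : (i < m)%N ->
    mdvd (u - (q ^+ (l + i))%:MP * v) (qprod Q m u (Q ^+ l * v)).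
  by move=> im; rewrite expq_factor; apply: qprod_dvd.
have dvd_refl (u v : S) : mdvd u (u * v) by exists v.
have hmul (d1 d2 d3 d4 : nat) (u1 u2 u3 u4 : S) :
    u1 \is d1.-homog -> u2 \is d2.-homog -> u3 \is d3.-homog -> u4 \is d4.-homog ->
    u1 * u2 * u3 * u4 \is (d1 + d2 + d3 + d4).-homog.
  by move=> *; do 3!(apply: dhomogM => //).
have [||||||||s1 [s2 basis]] := @saito_criterion K (triangle k m)
  (field_of A B C (x ^+ N.+1) (y ^+ N.+1) (z ^+ N.+1))
  (field_of A B C (x * g2 * b * c) (- (y * g3 * a * c)) (- (z * g1 * a * b)))
  (m + k) (m + m - k) (det3 (A 0) (B 0) (C 0)).
- by apply: triangle_arrangement; rewrite -mkN leq_addr.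
- by rewrite size_triangle.
- by rewrite mkN; apply: dhomog_field_of; rewrite -[X in X.-homog]mul1n; apply: dhomogMn.
- by rewrite degE; apply: dhomog_field_of; rewrite ?rpredN; apply: hmul.
- by apply: logarithmic_triangle => [|||i _|i _|i _]; first [exact: pow | rewrite exprS].
- apply: logarithmic_triangle => [||| i im | i im | i im].
  + by rewrite -!mulrA.
  + by exists (- (g3 * a * c)); rewrite -!mulrA; ring.
  + by exists (- (g1 * a * b)); rewrite -!mulrA; ring.
  (* Modulo the line, [w * y] becomes [x] and the expression becomes [x * c * h1], which the line
     divides; the two other pencils are treated alike with [h2] and [h3]. *)
  + set w := (q ^+ _)%:MP; have -> : x * g2 * b * c - w * - (y * g3 * a * c) =
      h1 * (x * c) + (x - w * y) * - (g3 * a * c) by rewrite E1; ring.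
    by apply: mdvdD => //; apply/mdvd_mulr/dvd_h.
  + set w := (q ^+ _)%:MP; have -> : - (z * g1 * a * b) - w * - (y * g3 * a * c) =
      h2 * (- z * a) + (z - w * y) * - (g3 * a * c) by rewrite E2; ring.
    by apply: mdvdD => //; apply/mdvd_mulr/dvd_h.
  set w := (q ^+ _)%:MP; have -> : x * g2 * b * c - w * - (z * g1 * a * b) =
    h3 * (x * b) + (x - w * z) * - (g1 * a * b) by rewrite E3; ring.
  by apply: mdvdD => //; apply/mdvd_mulr/dvd_h.
- exact: det3_frame_neq0.
- rewrite det3_field_of // defining_equation_triangle; congr (_ *: _).
  rewrite -/h1 -/h2 -/h3 !exprS.
  (* Each difference of powers is some [g * h]; after expressing [h1], [h2], [h3] through the
     cofactors, the bracket is their product. *)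
  transitivity (x * y * z * ((x ^+ N - y ^+ N) * g1 * a * b
    - (x ^+ N - z ^+ N) * g3 * a * c + (z ^+ N - y ^+ N) * g2 * b * c)); first by ring.
  by rewrite -gh1 -gh2 -gh3 E1 E2 E3; ring.
exact: syzygy_basis_free basis.
Qed.

(** The fields taking [(x, y, z)] to [(x, 0, 0)] and to [(0, y, 0)] are tangent to the sides and
    satisfy Saito's criterion. *)
Lemma sides_free : free_with_exponents (triangle 0 0) 1 1.
Proof.
have hx := dhomog_linear_form (line 1 0 0).
have hy := dhomog_linear_form (line 0 1 0).
have dvd0 (u : S) : mdvd u 0 by exists 0; rewrite mulr0.
have dvdxx (u : S) : mdvd u u by exists 1; rewrite mulr1.
have [||||||||s1 [s2 basis]] := @saito_criterion K (triangle 0 0)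
  (field_of A B C x 0 0) (field_of A B C 0 y 0) 0 0 (det3 (A 0) (B 0) (C 0)).
- exact: triangle_arrangement.
- by [].
- by apply: dhomog_field_of; rewrite ?rpred0.
- by apply: dhomog_field_of; rewrite ?rpred0.
- exact: logarithmic_triangle.
- exact: logarithmic_triangle.
- exact: det3_frame_neq0.
- rewrite det3_field_of // defining_equation_triangle !qprod0; congr (_ *: _).
  by ring.
exact: syzygy_basis_free basis.
Qed.

End Construction.

(** * Choice of the root of unity and of the parameters *)

Lemma exists_primitive_root (K : numClosedFieldType) n :
  (0 < n)%N -> exists q : K, n.-primitive_root q.
Proof.
move=> n0; have [r rE] := closed_field_poly_normal ('X^n - 1 : {poly K}).
rewrite (monicP _) ?monicXnsubC // scale1r in rE.
have r1 : all n.-unity_root r by apply/allP => u; rewrite -root_prod_XsubC -rE.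
have sz : (n < (size r).+1)%N by rewrite -(size_prod_XsubC r id) -rE size_XnsubC.
(* [n] distinct [n]-th roots of unity include a primitive one; they are distinct because ['X^n - 1]
   is separable in characteristic zero. *)
have [|u] := hasP (has_prim_root n0 r1 _ sz); last by exists u.
by rewrite -separable_prod_XsubC -rE separable_Xn_sub_1 // pnatr_eq0 -lt0n.
Qed.

Theorem corollary4p3 (R : realType) (A B C : 'rV[R[i]%C]_3)
    (hABC : non_aligned A B C)
    (n : nat) (hn : (0 < n)%N) (d1 d2 : int)
    (hsum : d1 + d2 = 3 * n%:Z - 1)
    (hn1 : n%:Z <= d1) (h12 : d1 <= d2) (h2n : d2 <= 2 * n%:Z - 1) :
  exists L : seq 'rV[R[i]%C]_3,
    Tr A B C n n n L /\ free_with_exponents L d1 d2.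
Proof.
case: n hn hsum hn1 h2n => // m _ hsum hn1 h2n.
have [k d1E] : exists k : nat, d1 = (m + k).+1%N%:Z by exists `|d1 - m.+1%:Z|%N; lia.
(* This is [d1 <= d2] rewritten, as [d1 = m + k + 1] and [d2 = 2m - k + 1]. *)
have km : (k + k <= m)%N by lia.
have d2E : d2 = (m + m - k).+1%N%:Z by lia.
rewrite {}d1E {}d2E in hsum hn1 h12 h2n *.
have root_neq0 N (q : R[i]%C) : N.-primitive_root q -> q != 0.
  move=> qN; apply: contra_eq_neq (prim_expr_order qN) => ->.
  by rewrite expr0n gtn_eqF ?(prim_order_gt0 qN) // eq_sym oner_eq0.
have [m0|m0] := posnP m.
  (* Here [m + k = 0] and there is no root of that order; a root of order 1 serves as a parameter,
     the arrangement being just the three sides. *)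
  have k0 : k = 0%N by lia.
  have [q q1] := @exists_primitive_root R[i]%C 1 isT.
  subst m k; exists (triangle A B C q 0 0); split.
    exact: (triangle_Tr hABC (root_neq0 _ _ q1) q1).
  exact: (sides_free hABC (root_neq0 _ _ q1) q1).
have [q qN] : exists q : R[i]%C, (m + k).-primitive_root q.
  by apply: exists_primitive_root; rewrite addn_gt0 m0.
have q0 := root_neq0 _ _ qN.
exists (triangle A B C q k m); split.
  by apply: (triangle_Tr hABC q0 qN); rewrite leq_addr.
exact: (triangle_free hABC q0 qN).
Qed.
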